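(* The properties $MAC$ and $M'AC$ are not commensurability invariant, and hence also not quasi-isometry invariant. That is, for each property $\mathcal{Q}\in\{MAC, M'AC\}$ there exist groups $G$ and $H$ with finite generating sets $A$ and $B$, respectively, such that $G$ and $H$ are commensurable (and hence quasi-isometric), the pair $(G,A)$ has property $\mathcal{Q}$, and the pair $(H,B)$ does not have property $\mathcal{Q}$.
   Context: For a group $G$ with finite generating set $A$, let $\Gamma$ be the corresponding Cayley graph, regarded as a metric graph with path metric $d$ (each edge has length 1), and let $S(r)$ and $B(r)$ denote the sphere and the (closed) ball of radius $r$ in $\Gamma$ centred at the identity vertex. For a function $f:\mathbb{N}\to\mathbb{R}_+$ and $r_0\in\mathbb{N}$, the pair $(G,A)$ satisfies the condition $AC_{f,r_0}$ if for every natural number $r\ge r_0$ and every pair of vertices $a,b\in S(r)$ with $d(a,b)\le 2$ there is a path inside $B(r)$ from $a$ to $b$ of length at most $f(r)$. The pair $(G,A)$ is $MAC$ (minimally almost convex) if $AC_{f,r_0}$ holds for $f(r)=2r-1$ and some $r_0\in\mathbb{N}$; it is $M'AC$ if $AC_{f,r_0}$ holds for $f(r)=2r-2$ and some $r_0\in\mathbb{N}$. Two groups are commensurable if they have isomorphic finite index subgroups. *)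

(* Defs.v *)
From HB Require Import structures.
From mathcomp Require Import all_boot all_order all_algebra.
From mathcomp Require Import classical_sets functions cardinality reals.

Set Implicit Arguments.
Unset Strict Implicit.
Unset Printing Implicit Defensive.

Import Order.TTheory GRing.Theory Num.Theory.
Local Open Scope classical_set_scope.
Local Open Scope ring_scope.

Definition subgroup (G : groupType) (K : set G) : Prop := group_closed (mem K).

Definition generates (G : groupType) (A : set G) : Prop :=
  forall K : set G, subgroup K -> A `<=` K -> K = setT.

Definition finite_generating (G : groupType) (A : set G) : Prop :=
  finite_set A /\ generates A.

(* finitely many left cosets g K *)
Definition finite_index (G : groupType) (K : set G) : Prop :=
  finite_set (range (fun g : G => [set (g * k)%g | k in K])).

Definition commensurable (G H : groupType) : Prop :=
  exists (K : set G) (L : set H) (phi : G -> H),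
    [/\ subgroup K /\ finite_index K,
        subgroup L /\ finite_index L,
        set_bij K L phi
      & {in K &, {morph phi : x y / (x * y)%g}}].

Definition quasi_isometric (R : realType) (X Y : Type)
    (dX : X -> X -> R) (dY : Y -> Y -> R) : Prop :=
  exists (f : X -> Y) (k c : R),
    [/\ 1 <= k, 0 <= c,
        forall x x', k^-1 * dX x x' - c <= dY (f x) (f x') <= k * dX x x' + c
      & forall y, exists x, dY (f x) y <= c].

(* The Cayley graph of (G, A) has vertex set G and, for every g in G and a in
   A, an edge (g, a) joining g to g * a.  [edge_path A E u v n]: there is an
   edge path from u to v with n edges, traversed in either direction, all of
   them belonging to the set E. *)
Inductive edge_path (G : groupType) (A : set G) (E : set (G * G)) :
    G -> G -> nat -> Prop :=
| EdgePath0 u : edge_path A E u u 0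
| EdgePathFwd u a v n : A a -> E (u, a) ->
    edge_path A E (u * a)%g v n -> edge_path A E u v n.+1
| EdgePathBwd u a v n : A a -> E (u, a) ->
    edge_path A E u v n -> edge_path A E (u * a)%g v n.+1.

(* As [inf set0 = 0], this is meaningful only when A generates G. *)
Definition dist (R : realType) (G : groupType) (A : set G) (u v : G) : R :=
  inf [set n%:R | n in edge_path A setT u v].

(* The distance, in the metric graph, from the vertex x to the point of the
   edge e = (g, a) that lies at distance t from g along e (0 <= t <= 1): a
   shortest path enters e through one of its endpoints g and g * a. *)
Definition dist_point (R : realType) (G : groupType) (A : set G)
    (x : G) (e : G * G) (t : R) : R :=
  Num.min (dist R A x e.1 + t) (dist R A x (e.1 * e.2)%g + (1 - t)).

(* All points of the edge, not just its endpoints, lie in the closed ball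
   B(r): an edge joining two vertices of S(r) is not contained in B(r). *)
Definition edge_in_ball (R : realType) (G : groupType) (A : set G) (r : nat) :
    set (G * G) :=
  [set e | forall t : R, 0 <= t <= 1 -> dist_point A 1%g e t <= r%:R].

Definition sphere (R : realType) (G : groupType) (A : set G) (r : nat) :
    set G :=
  [set g | dist R A 1%g g = r%:R].

Definition AC (R : realType) (G : groupType) (A : set G)
    (f : nat -> R) (r0 : nat) : Prop :=
  forall r : nat, (r0 <= r)%N ->
  forall a b : G, sphere R A r a -> sphere R A r b -> dist R A a b <= 2%:R ->
  exists n : nat, edge_path A (edge_in_ball R A r) a b n /\ n%:R <= f r.

Definition MAC (R : realType) (G : groupType) (A : set G) : Prop :=
  exists r0 : nat, AC A (fun r => 2%:R * r%:R - 1 : R) r0.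

Definition MpAC (R : realType) (G : groupType) (A : set G) : Prop :=
  exists r0 : nat, AC A (fun r => 2%:R * r%:R - 2%:R : R) r0.

(* Main.v *)
Require Import Defs.
From HB Require Import structures.
From mathcomp Require Import all_boot all_order all_algebra.
From mathcomp Require Import classical_sets functions cardinality reals.
From mathcomp Require Import boolp zify ring lra.

(* In BS(1,2) = Z[1/2] x| Z, with elements (u, k), the generating set {t, at} has property M'AC
   while {t, at, a^2 t} does not have MAC. Both Cayley graphs are bipartite, by the
   parity of the height k.

   A path which starts at the origin and stays between the heights -m and h moves u by at most
   a constant times 2^h. In both cases the ball of radius r = 2m + 2h - 1 contains points of height
   1 and of height -1 far away from the origin, but points of height 0 only at about half this
   distance; two points of the sphere which are separated in this way can only be joined
   inside the ball by returning about halfway. For {t, at, a^2 t} the two halves are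
   slightly too long, so that there is nothing shorter than the path through the
   origin. For {t, at} one of the halves is short enough for a path over a peak of height h - 1, which
   saves 2. In nearly all the other positions, two points of the sphere at distance 2 have geodesics
   from the origin with the same first edge. *)

Set Implicit Arguments.
Unset Strict Implicit.
Unset Printing Implicit Defensive.
Import Order.TTheory GRing.Theory Num.Theory.
Local Open Scope ring_scope.

(** * Dyadic numbers *)

(** One group with two generating sets settles both properties: M'AC implies MAC, so the positive
    example is treated for the stronger property and the negative one for the weaker, and the
    commensurability is that of a group with itself. The obstacle is that the balls for {t, at} must
    be known exactly, since a single unit of length decides. The inequalities of [box] achieve this:
    membership in a ball becomes linear arithmetic over the rationals together with a condition on
    denominators, and strict inequalities are sharpened by the gaps between dyadic numbers. A point
    has several boxes, and two points at distance 2 may be seen in boxes that suggest different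
    first steps; lowering [m] in favour of [h] at equal length usually brings them together. The
    symmetry of the two generators leaves the half [2 * u >= 2 ^ k - 1]. For an integral coordinate
    at positive height, parity fixes the first step of a path that never goes below height 0. *)

Definition pw (k : int) : rat := 2%:R ^ k.

Lemma pw_gt0 k : 0 < pw k.
Proof. exact: exprz_gt0. Qed.

Lemma pwD k l : pw (k + l) = pw k * pw l.
Proof. exact: expfzDr. Qed.

Lemma pw0 : pw 0 = 1. Proof. by []. Qed.

Lemma pwS k : pw (k + 1) = 2 * pw k.
Proof. by rewrite pwD mulrC. Qed.

Lemma pwB1 k : pw (k - 1) = pw k / 2.
Proof. by rewrite pwD. Qed.

Lemma pwN k : pw k * pw (- k) = 1.
Proof. by rewrite -pwD subrr. Qed.

Lemma pw_int (n : nat) : pw n \is a Num.int.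
Proof. by rewrite /pw rpredX // intr_nat. Qed.

Lemma ler_pw (k l : int) : k <= l -> pw k <= pw l.
Proof. by move=> kl; rewrite /pw ler_eXz2l // ltr1n. Qed.

Lemma ltr_pw (k l : int) : k < l -> 2 * pw k <= pw l.
Proof. by move=> kl; rewrite -pwS; apply: ler_pw; lia. Qed.

(** The group of multiples of [2 ^ - m]. Negative [m] is meant: [dy (-1)] is the set of even
    integers, in which the parity arguments are phrased. *)
Definition dy (m : int) (u : rat) : bool := u * pw m \is a Num.int.

Lemma dyD m u v : dy m u -> dy m v -> dy m (u + v).
Proof. by rewrite /dy mulrDl => *; rewrite rpredD. Qed.

Lemma dyN m u : dy m (- u) = dy m u.
Proof. by rewrite /dy mulNr rpredN. Qed.

Lemma dyB m u v : dy m u -> dy m v -> dy m (u - v).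
Proof. by move=> du dv; rewrite dyD // dyN. Qed.

Lemma dyS m u : dy (m - 1) (2 * u) = dy m u.
Proof. by rewrite /dy pwB1; congr (_ \is a _); field. Qed.

Lemma dyP m u : dy (m + 1) (u / 2) = dy m u.
Proof. by rewrite /dy pwS; congr (_ \is a _); field. Qed.

Lemma dyW (m m' : int) u : m <= m' -> dy m u -> dy m' u.
Proof.
move=> mm'; have [n ->] : exists n : nat, m' = m + n%:Z by exists `|m' - m|%N; lia.
by rewrite /dy pwD mulrA => du; rewrite rpredM // pw_int.
Qed.

Lemma dy_pw (m k : int) : - m <= k -> dy m (pw k).
Proof.
move=> mk; rewrite /dy -pwD.
have [n ->] : exists n : nat, k + m = n%:Z by exists (absz (k + m)); lia.
exact: pw_int.
Qed.

Lemma dy_int m (n : int) : 0 <= m -> dy m n%:~R.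
Proof. by move=> m0; apply: (@dyW 0) => //; rewrite /dy mulr1 intr_int. Qed.

Lemma dy_nat (m : int) (n : nat) : 0 <= m -> dy m n%:R.
Proof. exact: (@dy_int m n). Qed.

Lemma dy1 (m : int) : 0 <= m -> dy m 1.
Proof. exact: (@dy_nat m 1). Qed.

Lemma dy_ge m u : dy m u -> 0 < u -> pw (- m) <= u.
Proof.
move=> du u0; have um0 : 0 < u * pw m by rewrite mulr_gt0 ?pw_gt0.
have : 1 <= u * pw m.
  move/intrP: du um0 => [n ->]; rewrite ltr0z => n0.
  by rewrite (_ : 1 = 1%:~R) // ler_int; lia.
have := pwN m; have := pw_gt0 (- m) => p0 pN h.
have : pw (- m) * 1 <= pw (- m) * (u * pw m) by rewrite ler_pM2l.
by rewrite mulr1 mulrCA (mulrC (pw (- m))) pN mulr1.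
Qed.

(** Converts the exclusion of one extreme value into a bound improved by [2 ^ - m], which is how the
    sharp bounds of a smaller box are reached. *)
Lemma dy_gap m u v : dy m u -> dy m v -> u < v -> u + pw (- m) <= v.
Proof.
move=> du dv uv; have := dy_ge (dyB dv du); rewrite subr_gt0 => /(_ uv) ?; lra.
Qed.

Lemma dy0P u : dy 0 u -> exists n : int, u = n%:~R.
Proof. by rewrite /dy mulr1 => /intrP. Qed.

Lemma dy0_parity u : dy 0 u -> dy (-1) u || dy (-1) (u - 1).
Proof.
move=> /dy0P[n ->].
have [e|o] : (n = 2 * (n %/ 2)%Z \/ n = 2 * (n %/ 2)%Z + 1) by lia.
  apply/orP; left; rewrite e intrM (dyS 0); exact: dy_int.
apply/orP; right; rewrite o intrD addrK intrM (dyS 0); exact: dy_int.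
Qed.

Lemma dy_odd u : dy (-1) u -> dy (-1) (u - 1) -> False.
Proof.
move=> du dv; have := dyB du dv; rewrite (_ : u - (u - 1) = 1); last by ring.
by move/dy_ge => /(_ ltr01).
Qed.

Lemma pwNS m : pw (- (m + 1)) = pw (- m) / 2.
Proof. by rewrite opprD pwB1. Qed.

Lemma pwNB1 m : pw (- (m - 1)) = 2 * pw (- m).
Proof. by rewrite opprB addrC pwS. Qed.

Lemma pw_le1 (k : int) : k <= 0 -> pw k <= 1.
Proof. exact: (@ler_pw k 0). Qed.

Lemma pw_ge1 (k : int) : 0 <= k -> 1 <= pw k.
Proof. exact: (@ler_pw 0 k). Qed.

(** * Paths and boxes *)

Definition vert : Type := (rat * int)%type.

(* The points reached from the origin by a path of length [2 * m + 2 * h - `|g.2|] with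
   minimal height [- m] and maximal height [h]. In the coordinate [x = 2 * u - 2 ^ k + 1], which makes
   the two generators symmetric, the four bounds say that
   [`|x| + `|2 ^ k - 1| <= 2 * (2 ^ h - 2 ^ - m)]. *)
Record box (m h : int) (g : vert) : Prop := Box {
  box_m : 0 <= m;
  box_h : 0 <= h;
  box_lo : - m <= g.2;
  box_hi : g.2 <= h;
  box_dy : dy m g.1;
  box_1 : g.1 <= pw h - pw (- m);
  box_2 : - (pw h - pw (- m)) <= g.1;
  box_3 : g.1 <= pw g.2 - 1 + (pw h - pw (- m));
  box_4 : pw g.2 - 1 - (pw h - pw (- m)) <= g.1 }.

(* The ball of radius [n] for two generators, see [in_ball_walk] and [in_ball_ex_walk]. *)
Definition in_ball (n : nat) (g : vert) : Prop :=
  exists m h : int, box m h g /\ 2 * m + 2 * h <= n%:Z + `|g.2|.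

Lemma in_ballW n n' g : (n <= n')%N -> in_ball n g -> in_ball n' g.
Proof. by move=> nn' [m [h [b c]]]; exists m, h; split=> //; lia. Qed.

Lemma box_in_ball m h g (n : nat) : box m h g -> 2 * m + 2 * h <= n%:Z + `|g.2| -> in_ball n g.
Proof. by exists m, h. Qed.


(* Without unrelated hypotheses [lia] and [lra] are much faster. *)
Ltac ilia := repeat match goal with
  | H : is_true (@Order.le _ ?T _ _) |- _ => unify (Order.Preorder.sort T) int; revert H
  | H : is_true (@Order.lt _ ?T _ _) |- _ => unify (Order.Preorder.sort T) int; revert H
  | H : is_true (@Order.le _ ?T _ _ && _) |- _ => unify (Order.Preorder.sort T) int; revert H
  | H : is_true (@Order.lt _ ?T _ _ && _) |- _ => unify (Order.Preorder.sort T) int; revert H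
  | H : is_true (~~ (@eq_op ?T _ _)) |- _ => unify (Equality.sort T) int; revert H
  | H : is_true (_ <= _)%N |- _ => revert H
  | H : @eq ?T _ _ |- _ => unify T int; revert H
  | H : @eq ?T _ _ |- _ => unify T nat; revert H
  end; clear; intros; lia.
Ltac rlra := repeat match goal with
  | H : is_true (@Order.le _ ?T _ _) |- _ => unify (Order.Preorder.sort T) rat; revert H
  | H : is_true (@Order.lt _ ?T _ _) |- _ => unify (Order.Preorder.sort T) rat; revert H
  | H : @eq ?T _ _ |- _ => unify T rat; revert H
  end; clear; intros; lra.
Ltac isint := match goal with
  | |- is_true (@Order.le _ ?T _ _) => unify (Order.Preorder.sort T) int
  end.
Ltac box_tac := split; rewrite /=; try (isint; ilia).
(** Trades depth for height at equal [m + h]: the new bound is the old one multiplied by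
    [2 ^ (m - m')]. Its purpose is to give two points boxes of equal depth, or to give a box with
    [h = 0] a positive height. *)
Lemma box_norm (m m' h : int) g : 0 <= m' <= m -> - m' <= g.2 -> dy m' g.1 ->
  box m h g -> box m' (h + (m - m')) g.
Proof.
move=> /andP[m'0 m'm] lo d [_ h0 _ hi _ b1 b2 b3 b4].
have hh : pw h - pw (- m) <= pw (h + (m - m')) - pw (- m').
  have p1 := pw_ge1 h0.
  have p2 : 1 <= pw (m - m') by apply: pw_ge1; ilia.
  have p3 : pw (- m') <= 1 by apply: pw_le1; ilia.
  have e : pw (- m') = pw (m - m') * pw (- m) by rewrite -pwD; congr pw; ring.
  have p4 : pw (- m) <= 1 by apply: pw_le1; ilia.
  have p5 := pw_gt0 (- m).
  rewrite pwD e; move: (pw h) (pw (m - m')) (pw (- m)) p1 p2 p4 p5 => H X Q *.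
  have : 0 <= (X - 1) * (H - Q) by apply: mulr_ge0; lra.
  rewrite mulrBl !mulrBr; lra.
box_tac => //; lra.
Qed.

(* Right multiplication by the generator [(i, 1)]. *)
Definition upv (i : nat) (p : vert) : vert := (p.1 + i%:R * pw p.2, p.2 + 1).

Definition up (d : nat) (p q : vert) : Prop := exists2 i : nat, (i <= d)%N & q = upv i p.

Definition adj (d : nat) (p q : vert) : Prop := up d p q \/ up d q p.

Inductive walk (d : nat) (S : vert -> Prop) : vert -> vert -> nat -> Prop :=
| Walk0 p : S p -> walk d S p p 0
| WalkS p q r n : S p -> adj d p q -> walk d S q r n -> walk d S p r n.+1.

Lemma adj_sym d p q : adj d p q -> adj d q p.
Proof. by case=> ?; [right|left]. Qed.

Lemma walk_fst d S p q n : walk d S p q n -> S p.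
Proof. by case. Qed.

Lemma walk_lst d S p q n : walk d S p q n -> S q.
Proof. by elim. Qed.

Lemma walk_cat d S p q r n n' :
  walk d S p q n -> walk d S q r n' -> walk d S p r (n + n').
Proof.
elim=> // {}p s {}q {}n Sp ps _ IH /IH w.
exact: WalkS ps w.
Qed.

Lemma walk1 d (S : vert -> Prop) p q : S p -> S q -> adj d p q -> walk d S p q 1.
Proof. by move=> Sp Sq pq; apply: WalkS pq (Walk0 _ Sq). Qed.

Lemma walk_rev d S p q n : walk d S p q n -> walk d S q p n.
Proof.
elim=> [{}p Sp|{}p {}q r {}n Sp pq w IH]; first exact: Walk0.
rewrite -addn1; apply: walk_cat IH _.
exact: walk1 (walk_fst w) Sp (adj_sym pq).
Qed.

Definition tr (p g : vert) : vert := (p.1 + pw p.2 * g.1, p.2 + g.2).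
Definition iv (p : vert) : vert := (- (pw (- p.2) * p.1), - p.2).

Lemma trA p q r : tr p (tr q r) = tr (tr p q) r.
Proof. by rewrite /tr /= pwD; congr pair; ring. Qed.

Lemma trV p : tr p (iv p) = (0, 0).
Proof. by rewrite /tr /= subrr mulrN mulrA pwN mul1r subrr. Qed.

Lemma Vtr p : tr (iv p) p = (0, 0).
Proof. by rewrite /tr /= addNr addNr. Qed.

Lemma tr1 p : tr (0, 0) p = p.
Proof. by rewrite /tr /= pw0 mul1r !add0r; case: p. Qed.

Lemma trg1 p : tr p (0, 0) = p.
Proof. by rewrite /tr /= mulr0 !addr0; case: p. Qed.

Lemma tr_upv p i q : tr p (upv i q) = upv i (tr p q).
Proof. by rewrite /tr /upv /= pwD; congr pair; ring. Qed.

Lemma adj_tr d p q r : adj d q r -> adj d (tr p q) (tr p r).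
Proof.
by case=> -[i il ->]; [left|right]; exists i => //; rewrite tr_upv.
Qed.

Lemma walk_tr d (S S' : vert -> Prop) p q r n : (forall g, S g -> S' (tr p g)) ->
  walk d S q r n -> walk d S' (tr p q) (tr p r) n.
Proof.
move=> SS'; elim=> [{}q /SS'|{}q s {}r {}n /SS' Sq qs _ IH]; first exact: Walk0.
exact: WalkS (adj_tr p qs) IH.
Qed.

(** * The ball as a union of boxes *)

Lemma in_ball_adj n p q : in_ball n p -> adj 1 p q -> in_ball n.+1 q.
Proof.
case: p q => [u k] [u' k'] [m [h [[/= m0 h0 lo hi d b1 b2 b3 b4] c]]].
have Q0 := pw_gt0 (- m); have K0 := pw_gt0 k.
have Q1 : pw (- m) <= 1 by apply: pw_le1; ilia.
have KH := ler_pw hi; have H1 := pw_ge1 h0.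
have p1 (i : nat) : (i <= 1)%N -> i%:R * pw k = 0 \/ i%:R * pw k = pw k.
  by case: i => [|[|i]] // _; [left; rewrite mul0r|right; rewrite mul1r].
have p2 (i : nat) : (i <= 1)%N -> i%:R * pw k' = 0 \/ i%:R * pw k' = pw k'.
  by case: i => [|[|i]] // _; [left; rewrite mul0r|right; rewrite mul1r].
(* A step towards height 0 does not change [n + |k|], so the same box must do; there the third and
   fourth bounds absorb the step. A step away from height 0 gains 2, spent on [h], or on [m] if the
   step leaves the bottom of the box. *)
case=> -[i il [] /= E1 E2]; subst.
  have du : dy m (u + i%:R * pw k).
    by case: (p1 i il) => ->; rewrite ?addr0 // dyD // dy_pw.
  case: (lerP 0 k) => k0.
    exists m, (h + 1); split; last by rewrite /=; ilia.
    by box_tac => //; rewrite !pwS; have := pw_ge1 k0; case: (p1 i il) => ->; rlra.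
  exists m, h; split; last by rewrite /=; ilia.
  have : 2 * pw k <= 1 by apply: (@ltr_pw k 0).
  by box_tac => //; rewrite ?pwS; case: (p1 i il) => ->; rlra.
move: K0 KH b1 b2 b3 b4; rewrite !pwS => K0 KH b1 b2 b3 b4.
case: (ltrP 0 (k' + 1)) => k0.
  have du : dy m u'.
    rewrite -[u'](addrK (i%:R * pw k')) dyB //.
    case: (p2 i il) => ->; last by rewrite dy_pw //; ilia.
    by rewrite -(mul0r 1) -[0%R](@natrM rat 0 0) mulr1 dy_nat.
  have k'1 : 1 <= pw k' by apply: pw_ge1; ilia.
  exists m, h; split; last by rewrite /=; ilia.
  by box_tac => //; case: (p2 i il) => E; rewrite E in b1 b2 b3 b4; rlra.
have k1 : 2 * pw k' <= 1 by rewrite -pwS pw_le1.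
case: (lerP (- m) k') => lo'.
  have du : dy m u'.
    rewrite -[u'](addrK (i%:R * pw k')) dyB //.
    case: (p2 i il) => ->; last by rewrite dy_pw //; ilia.
    by rewrite -(mul0r 1) -[0%R](@natrM rat 0 0) mulr1 dy_nat.
  exists m, (h + 1); split; last by rewrite /=; ilia.
  by box_tac => //; rewrite ?pwS; case: (p2 i il) => E; rewrite E in b1 b2 b3 b4; rlra.
have Ek : k' = - (m + 1) by move: lo; rewrite /=; ilia.
have du : dy (m + 1) u'.
  rewrite -[u'](addrK (i%:R * pw k')) dyB //; first by apply: dyW d; ilia.
  case: (p2 i il) => ->; last by rewrite dy_pw //; ilia.
  by rewrite -(mul0r 1) -[0%R](@natrM rat 0 0) mulr1 dy_nat; ilia.
have E' : pw k' = pw (- m) / 2 by rewrite Ek pwNS.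
exists (m + 1), h; split; last by rewrite /=; ilia.
by box_tac => //; rewrite ?pwNS; case: (p2 i il) => E; rewrite E in b1 b2 b3 b4; rlra.
Qed.

Lemma in_ball0 : in_ball 0 (0, 0).
Proof. by exists 0, 0; split=> //; split=> //=; rewrite /dy ?mul0r //. Qed.

Lemma in_ball_walk S n n' p q : in_ball n p -> walk 1 S p q n' -> in_ball (n + n') q.
Proof.
move=> okp w; elim: w n okp => [{}p _ n|{}p {}q r {}n' _ pq _ IH n okp]; first by rewrite addn0.
by rewrite addnS -addSn; apply: IH; apply: in_ball_adj pq.
Qed.

Lemma dy_parity m u : dy m u -> dy (m - 1) u || dy (m - 1) (u - pw (- m)).
Proof.
have e v : dy (m - 1) v = dy (-1) (v * pw m).
  by rewrite /dy pwB1 -mulrA.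
move=> du; have : dy 0 (u * pw m) by move: du; rewrite /dy mulr1.
move/dy0_parity => /orP[h|h]; apply/orP; [left|right]; rewrite e //.
by rewrite mulrBl (mulrC (pw (- m))) pwN.
Qed.

Lemma dy_pw_odd m : ~~ dy (m - 1) (pw (- m)).
Proof.
apply/negP => /dy_ge /(_ (pw_gt0 _)); rewrite pwNB1; have := pw_gt0 (- m); rlra.
Qed.

(** Greedy choice: [u] is kept unless this violates the upper bound at height [k - 1], and then
    there is room below to subtract [2 ^ (k - 1)]. *)
Lemma box_down m h u k : box m h (u, k) -> - m < k <= 0 ->
  exists2 v, box m h (v, k - 1) & adj 1 (u, k) (v, k - 1).
Proof.
case=> /= m0 h0 lo hi d b1 b2 b3 b4 /andP[mk k0].
have K0 := pw_gt0 k; have H1 := pw_ge1 h0.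
have Q1 : 2 * pw (- m) <= 1 by apply: (@ltr_pw (- m) 0); ilia.
have K1 := pw_le1 k0.
case: (lerP u (pw h - pw (- m) + pw k / 2 - 1)) => hu.
  exists u; first by box_tac => //; rewrite ?pwB1; rlra.
  by right; exists 0; rewrite // /upv /= mul0r addr0 subrK.
exists (u - pw (k - 1)).
  by box_tac; first (by rewrite dyB // dy_pw //; ilia); rewrite ?pwB1; rlra.
by right; exists 1; rewrite // /upv /= mul1r !subrK.
Qed.

(** At the bottom there is no choice: the step has to clear the last binary digit of [u], so that
    depth [m - 1] suffices afterwards. The value of this digit also excludes one extreme value of
    [u], and the gap gives the bounds of the smaller box. *)
Lemma box_up_bottom m h u : box m h (u, - m) -> 0 < m ->
  exists2 v, box (m - 1) h (v, - m + 1) & adj 1 (u, - m) (v, - m + 1).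
Proof.
case=> /= m0 h0 lo hi d b1 b2 b3 b4 m1.
have H1 := pw_ge1 h0; have Q0 := pw_gt0 (- m).
have Q1 : 2 * pw (- m) <= 1 by apply: (@ltr_pw (- m) 0); ilia.
have dQ : dy m (pw (- m)) by rewrite dy_pw.
have dH : dy (m - 1) (pw h) by rewrite dy_pw //; ilia.
have dm1 : m - 1 <= m by ilia.
have d1 : dy (m - 1) 1 by rewrite dy1 //; ilia.
have {}d := d; case/orP: (dy_parity d) => du.
  exists u; last by left; exists 0; rewrite // /upv /= mul0r addr0.
  have : - (pw h - pw (- m)) != u.
    apply/negP => /eqP E; move: (dy_pw_odd m).
    by rewrite (_ : pw (- m) = u + pw h) ?dyD // -E; ring.
  move=> ne; have lt : - (pw h - pw (- m)) < u by rewrite lt_neqAle ne.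
  have dR : dy m (- (pw h - pw (- m))) by rewrite dyN dyB // (dyW dm1).
  have := dy_gap dR d lt => ge.
  by box_tac; first done; rewrite ?pwNB1 ?pwS; rlra.
exists (u + pw (- m)); last by left; exists 1; rewrite // /upv /= mul1r.
have du' : dy (m - 1) (u + pw (- m)).
  rewrite (_ : u + pw (- m) = u - pw (- m) + 2 * pw (- m)); last by ring.
  by rewrite dyD // dyS.
have : u != pw h - 1.
  apply/negP => /eqP E; move: (dy_pw_odd m).
  by rewrite (_ : pw (- m) = (u + pw (- m)) - u) ?dyB //; [rewrite E dyB|ring].
move=> ne; have lt : u < pw h - 1 by rewrite lt_neqAle ne; rlra.
have dR : dy m (pw h - 1) by rewrite (dyW dm1) // dyB.
have := dy_gap d dR lt => ge.
by box_tac; first done; rewrite ?pwNB1 ?pwS; rlra.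
Qed.

Lemma box_up m h u k : box m h (u, k) -> 0 <= k < h ->
  exists2 v, box m h (v, k + 1) & adj 1 (u, k) (v, k + 1).
Proof.
case=> /= m0 h0 lo hi d b1 b2 b3 b4 /andP[k0 kh].
have K1 := pw_ge1 k0; have Q0 := pw_gt0 (- m).
have Q1 : pw (- m) <= 1 by apply: pw_le1; ilia.
have KH := ltr_pw kh.
case: (lerP (2 * pw k - 1 - (pw h - pw (- m))) u) => hu.
  exists u; first by box_tac => //; rewrite ?pwS; rlra.
  by left; exists 0; rewrite // /upv /= mul0r addr0.
exists (u + pw k).
  by box_tac; first (by rewrite dyD // dy_pw); rewrite ?pwS; rlra.
by left; exists 1; rewrite // /upv /= mul1r.
Qed.

(** At the top the leading digit is removed: [2 ^ (h - 1)] is subtracted exactly when [u] exceeds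
    the bound [2 ^ (h - 1) - 2 ^ - m] of the smaller box. *)
Lemma box_down_top m h u : box m h (u, h) -> 0 < h ->
  exists2 v, box m (h - 1) (v, h - 1) & adj 1 (u, h) (v, h - 1).
Proof.
case=> /= m0 h0 lo hi d b1 b2 b3 b4 h1.
have Q0 := pw_gt0 (- m).
have Q1 : pw (- m) <= 1 by apply: pw_le1; ilia.
have H1 : 2 <= pw h by rewrite -(mulr1 2); apply: (@ltr_pw 0).
have dH : dy m (pw (h - 1)) by rewrite dy_pw //; ilia.
have dh : dy m (pw h) by rewrite dy_pw //; ilia.
case: (lerP u (pw h - pw (- m) - pw (h - 1))) => hu.
  move: hu; rewrite pwB1 => hu.
  exists u; first by box_tac => //; rewrite ?pwB1; rlra.
  by right; exists 0; rewrite // /upv /= mul0r addr0 subrK.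
have dR : dy m (pw h - pw (- m) - pw (h - 1)) by rewrite !dyB // dy_pw.
have := dy_gap dR d hu; rewrite pwB1 => {}hu.
exists (u - pw (h - 1)).
  by box_tac; first (by rewrite dyB); rewrite ?pwB1; rlra.
by right; exists 1; rewrite // /upv /= mul1r !subrK.
Qed.

Lemma box_leh m h h' g : h <= h' -> box m h g -> box m h' g.
Proof.
move=> hh' [m0 h0 lo hi d b1 b2 b3 b4]; have := ler_pw hh' => H.
by box_tac => //; rlra.
Qed.

(** In this and the next lemmas [S] is tested on the boxes that the walk passes through, so that
    translates of the walk can later be confined to a ball. *)
Lemma to_top (S : vert -> Prop) m h g : box m h g -> 0 <= g.2 ->
    (forall q, box m h q -> g.2 <= q.2 -> S q) ->
  exists (v : rat) (n : nat),
    [/\ box m h (v, h), n%:Z = h - g.2 & walk 1 S g (v, h) n].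
Proof.
case: g => u k b; move: (b) => [_ _ _ /= kh _ _ _ _ _] k0.
have [n en] : exists n : nat, n%:Z = h - k by exists (absz (h - k)); ilia.
elim: n u k b kh k0 en => [|n IH] u k b kh k0 en HS.
  have e : k = h by ilia.
  by subst; exists u, 0%N; split=> //; apply: Walk0; apply: HS.
have [|v bv av] := box_up b; first by ilia.
have [||||w [n' [bw en' ww]]] := IH v (k + 1) bv; try ilia.
  by move=> q bq /= kq; apply: HS => //; ilia.
exists w, n'.+1; split=> //; first by ilia.
exact: WalkS (HS _ b _) av ww.
Qed.

(** Each vertex of the descent is at the top of its own box, hence [box m q.2 q]; for [m = 0] and
    [q = (v, j)] this gives [0 <= v <= 2 ^ j - 1]. *)
Lemma from_top (S : vert -> Prop) m h u : box m h (u, h) -> S (u, h) ->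
    (forall q, box m q.2 q -> 0 <= q.2 < h -> S q) ->
  exists (v : rat) (n : nat),
    [/\ box m 0 (v, 0), n%:Z = h & walk 1 S (u, h) (v, 0) n].
Proof.
move=> b; have [n en] : exists n : nat, n%:Z = h.
  by exists (absz h); case: b; ilia.
elim: n h u b en => [|n IH] h u b en Su HS.
  by subst; exists u, 0%N; split=> //; apply: Walk0.
have [|v bv av] := box_down_top b; first by ilia.
have [|||w [n' [bw en' ww]]] := IH (h - 1) v bv; try ilia.
- by apply: HS => //=; ilia.
- by move=> q bq q0; apply: HS => //; ilia.
by exists w, n'.+1; split=> //; [ilia|exact: WalkS Su av ww].
Qed.

Lemma box00 v : box 0 0 (v, 0) -> v = 0.
Proof. by case=> /= *; move: pw0; rlra. Qed.

Lemma to_bottom (S : vert -> Prop) m h g : box m h g -> g.2 <= 0 -> S g ->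
    (forall q, box m h q -> q.2 < 0 -> S q) ->
  exists (v : rat) (n : nat),
    [/\ box m h (v, - m), n%:Z = g.2 + m & walk 1 S g (v, - m) n].
Proof.
case: g => u k b; move: (b) => [_ _ /= km _ _ _ _ _ _] k0.
have [n en] : exists n : nat, n%:Z = k + m by exists (absz (k + m)); ilia.
elim: n u k b km k0 en => [|n IH] u k b km k0 en Su HS.
  have e : k = - m by ilia.
  by subst; exists u, 0%N; split=> //=; first [exact: Walk0|ilia].
have [|v bv av] := box_down b; first by ilia.
have [|||||w [n' [bw en' ww]]] := IH v (k - 1) bv; try ilia.
- by apply: HS => //=; ilia.
- exact: HS.
exists w, n'.+1; split=> //=; first by move: en' => /=; ilia.
exact: WalkS Su av ww.
Qed.

Lemma box_lem m m' h u k : m <= m' -> box m h (u, k) -> box m' h (u, k).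
Proof.
move=> mm' [/= m0 h0 lo hi d b1 b2 b3 b4].
have : pw (- m') <= pw (- m) by apply: ler_pw; ilia.
by move=> H; box_tac; [exact: dyW d|rlra..].
Qed.

Lemma from_bottom (S : vert -> Prop) m h u : box m h (u, - m) -> S (u, - m) ->
    (forall q, box m h q -> q.2 < 0 -> S q) ->
    (forall q, box 0 h q -> 0 <= q.2 -> S q) ->
  exists (v : rat) (n : nat),
    [/\ box 0 h (v, 0), n%:Z = m & walk 1 S (u, - m) (v, 0) n].
Proof.
move=> b; have [n en] : exists n : nat, n%:Z = m.
  by exists (absz m); case: b; ilia.
elim: n m u b en => [|n IH] m u b en Su HS HS0.
  by subst; exists u, 0%N; split=> //; apply: Walk0.
have [|v bv av] := box_up_bottom b; first by ilia.
rewrite (_ : - m + 1 = - (m - 1)) in bv av; last by ring.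
have Sv : S (v, - (m - 1)).
  have [m1|m1] := eqVneq m 1; first by rewrite m1 in bv *; apply: HS0.
  by apply: HS => /=; [apply: box_lem bv; ilia|ilia].
have [||q bq q0||w [n' [bw en' ww]]] := IH (m - 1) v bv; try done; try ilia.
  by apply: HS => //; case: q bq q0 => ? ? bq q0; apply: box_lem bq; ilia.
by exists w, n'.+1; split=> //; [ilia|exact: WalkS Su av ww].
Qed.

(** The route goes down to [- m], up to [h] and down to the origin, in [(k + m) + (m + h) + h]
    steps, where [k] is the height of [g]. *)
Lemma box_walk_neg (S : vert -> Prop) m h g : box m h g -> g.2 <= 0 -> S g ->
    (forall q, box m h q -> q.2 < 0 -> S q) ->
    (forall q, box 0 h q -> 0 <= q.2 -> S q) ->
  exists2 n : nat, n%:Z = 2 * m + 2 * h + g.2 & walk 1 S g (0, 0) n.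
Proof.
move=> b k0 Sg HS HS0.
have [v [n1 [b1 e1 w1]]] := to_bottom b k0 Sg HS.
have [v2 [n2 [b2 e2 w2]]] := from_bottom b1 (walk_lst w1) HS HS0.
have [v3 [n3 [b3 e3 w3]]] := to_top b2 isT HS0.
have [|v4 [n4 [b4 e4 w4]]] := from_top b3 (walk_lst w3).
  by move=> q bq qh; apply: HS0; [apply: box_leh bq|]; ilia.
rewrite (box00 b4) in w4.
exists (n1 + (n2 + (n3 + n4)))%N; first by move: e3; rewrite /=; ilia.
by apply: walk_cat w1 _; apply: walk_cat w2 _; apply: walk_cat w3 _.
Qed.

Definition anywhere : vert -> Prop := fun=> True.

Lemma box_walk m h g : box m h g ->
  exists2 n : nat, n%:Z = 2 * m + 2 * h - `|g.2| & walk 1 anywhere g (0, 0) n.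
Proof.
move=> b; case: (lerP g.2 0) => k0.
  by have [//|//|//|n en w] := @box_walk_neg anywhere _ _ _ b k0; exists n => //; ilia.
have [||v [n1 [b1 e1 w1]]] := @to_top anywhere _ _ _ b; [ilia|done|].
have [//|//|v2 [n2 [b2 e2 w2]]] := @from_top anywhere _ _ _ b1.
have [//|//|//|//|n3 e3 w3] := @box_walk_neg anywhere _ _ _ b2.
exists (n1 + (n2 + n3))%N; first by move: e3; rewrite /=; ilia.
by apply: walk_cat w1 _; apply: walk_cat w2 _.
Qed.

Lemma in_ball_ex_walk n g : in_ball n g -> exists2 n', (n' <= n)%N & walk 1 anywhere (0, 0) g n'.
Proof.
move=> [m [h [b c]]]; have [n' e w] := box_walk b.
by exists n'; [ilia|exact: walk_rev].
Qed.

(** * First steps of geodesics *)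

Definition conn (r : nat) (p q : vert) (n : nat) : Prop :=
  exists2 n', (n' <= n)%N & walk 1 (in_ball r) p q n'.

Lemma conn_sym r p q n : conn r p q n -> conn r q p n.
Proof. by case=> n' nn /walk_rev w; exists n'. Qed.

Lemma conn_trans r p q s n n' : conn r p q n -> conn r q s n' -> conn r p s (n + n').
Proof.
move=> [n1 h1 w1] [n2 h2 w2]; exists (n1 + n2)%N; first exact: leq_add.
exact: walk_cat w1 w2.
Qed.

Lemma connW r p q n n' : (n <= n')%N -> conn r p q n -> conn r p q n'.
Proof. by move=> nn [n1 h w]; exists n1 => //; apply: leq_trans nn. Qed.

Lemma walk_conn r p q n : walk 1 (in_ball r) p q n -> conn r p q n.
Proof. by exists n. Qed.

(** The bound is [r.+1] rather than [r]: all vertices but the last are within [s + n - 1] of the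
    origin, and the last one is in the ball by hypothesis. *)
Lemma walk_in_ball r s p q n : in_ball s p -> walk 1 anywhere p q n ->
  (s + n <= r.+1)%N -> in_ball r q -> walk 1 (in_ball r) p q n.
Proof.
move=> + w; elim: w s => [{}p _ s _ _|{}p q' {}q {}n _ pq _ IH s okp sn okq].
  exact: Walk0.
have okq' := in_ball_adj okp pq; apply: WalkS pq _; first by apply: in_ballW okp; ilia.
by apply: (IH s.+1) => //; ilia.
Qed.

Lemma conn_geo r s p q n : in_ball s p -> in_ball n (tr (iv p) q) -> (s + n <= r.+1)%N ->
  in_ball r q -> conn r p q n.
Proof.
move=> okp /in_ball_ex_walk[n' nn w] sn okq; exists n' => //.
have w' : walk 1 anywhere (tr p (0, 0)) (tr p (tr (iv p) q)) n'.
  by apply: walk_tr w.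
by move: w'; rewrite trA trV tr1 trg1 => w'; apply: (walk_in_ball okp) => //; ilia.
Qed.

Lemma walk_frame (S : vert -> Prop) w g n :
  walk 1 (fun q => S (tr w q)) (tr (iv w) g) (0, 0) n -> walk 1 S g w n.
Proof.
move=> /(@walk_tr 1 _ S w) W.
by have := W (fun _ h => h); rewrite trA trV tr1 trg1.
Qed.

Lemma conn1 r p q : in_ball r p -> in_ball r q -> adj 1 p q -> conn r p q 1.
Proof. by move=> ? ? ?; exists 1%N => //; apply: walk1. Qed.

Lemma tr_ivU (i : rat) u k : tr (iv (i, 1)) (u, k) = ((u - i) / 2, k - 1).
Proof.
rewrite /tr /iv /= (_ : pw (- (1)) = 1 / 2) //; congr pair; [by field|ring].
Qed.

Lemma tr_ivD (i : rat) u k : tr (iv (- (i / 2), -1)) (u, k) = (2 * u + i, k + 1).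
Proof.
by rewrite /tr /iv /= opprK (_ : pw 1 = 2) //; congr pair; [field|ring].
Qed.

Lemma tr_iv0 (x : rat) u k : tr (iv (x, 0)) (u, k) = (u - x, k).
Proof. by rewrite /tr /iv /= oppr0 pw0; congr pair; ring. Qed.

Lemma tr_0 (x : rat) q : tr (x, 0) q = (x + q.1, q.2).
Proof. by rewrite /tr /= pw0 mul1r add0r. Qed.

Lemma upvP i u k : upv i (u, k) = (u + i%:R * pw k, k + 1).
Proof. by []. Qed.

Lemma adjU0 u k : adj 1 (u, k) (u, k + 1).
Proof. by left; exists 0; rewrite // upvP mul0r addr0. Qed.

Lemma adjU1 u k : adj 1 (u, k) (u + pw k, k + 1).
Proof. by left; exists 1; rewrite // upvP mul1r. Qed.

Lemma in_ball1 p : adj 1 (0, 0) p -> in_ball 1 p.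
Proof. exact: in_ball_adj in_ball0. Qed.

Lemma in_ballU (i : nat) : (i <= 1)%N -> in_ball 1 (i%:R, 1).
Proof.
by move=> i1; apply: in_ball1; left; exists i; rewrite // upvP mulr1 !add0r.
Qed.

Lemma in_ballD (i : nat) : (i <= 1)%N -> in_ball 1 (- (i%:R / 2), -1).
Proof.
move=> i1; apply: in_ball1; right; exists i; rewrite // upvP.
by rewrite (_ : pw (-1) = 1 / 2) //; congr pair; ring.
Qed.

Lemma common_step r p a b : in_ball 1 p -> (0 < r)%N -> in_ball r a -> in_ball r b ->
  in_ball r.-1 (tr (iv p) a) -> in_ball r.-1 (tr (iv p) b) -> conn r a b (2 * r - 2).
Proof.
move=> okp r0 oka okb ha hb; rewrite (_ : 2 * r - 2 = r.-1 + r.-1)%N; last by ilia.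
apply: (@conn_trans _ _ p); last by apply: (conn_geo okp) => //; ilia.
by apply: conn_sym; apply: (conn_geo okp) => //; ilia.
Qed.

Lemma commonU (i : nat) r (u v : rat) (k l : int) : (i <= 1)%N -> (0 < r)%N ->
  in_ball r (u, k) -> in_ball r (v, l) ->
  in_ball r.-1 ((u - i%:R) / 2, k - 1) -> in_ball r.-1 ((v - i%:R) / 2, l - 1) ->
  conn r (u, k) (v, l) (2 * r - 2).
Proof.
by move=> i1 r0 *; apply: (common_step (in_ballU i1)); rewrite ?tr_ivU.
Qed.

Lemma commonD (i : nat) r (u v : rat) (k l : int) : (i <= 1)%N -> (0 < r)%N ->
  in_ball r (u, k) -> in_ball r (v, l) ->
  in_ball r.-1 (2 * u + i%:R, k + 1) -> in_ball r.-1 (2 * v + i%:R, l + 1) ->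
  conn r (u, k) (v, l) (2 * r - 2).
Proof.
by move=> i1 r0 *; apply: (common_step (in_ballD i1)); rewrite ?tr_ivD.
Qed.

(* The automorphism exchanging the two generators. *)
Definition mirror (g : vert) : vert := (pw g.2 - 1 - g.1, g.2).

Lemma mirrorK g : mirror (mirror g) = g.
Proof. by case: g => u k; rewrite /mirror /=; congr pair; ring. Qed.

Lemma box_mirror m h g : box m h g -> box m h (mirror g).
Proof.
case=> m0 h0 lo hi d b1 b2 b3 b4; box_tac; first by rewrite !dyB // ?dy1 // dy_pw.
all: rlra.
Qed.

Lemma in_ball_mirror n g : in_ball n g -> in_ball n (mirror g).
Proof. by move=> [m [h [b c]]]; exists m, h; split=> //; apply: box_mirror. Qed.

Lemma up_mirror p q : up 1 p q -> up 1 (mirror p) (mirror q).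
Proof.
case: p => u k [i i1 ->]; rewrite upvP /mirror /=; exists (1 - i)%N; first by ilia.
rewrite upvP pwS; congr pair.
by case: i i1 => [|[|i]] // _; rewrite ?subn0 ?subnn ?mul0r ?mul1r; ring.
Qed.

Lemma adj_mirror p q : adj 1 p q -> adj 1 (mirror p) (mirror q).
Proof. by case=> /up_mirror; [left|right]. Qed.

Lemma walk_mirror r p q n : walk 1 (in_ball r) p q n -> walk 1 (in_ball r) (mirror p) (mirror q) n.
Proof.
elim=> [{}p /in_ball_mirror|{}p s {}q {}n /in_ball_mirror Sp ps _ IH]; first exact: Walk0.
exact: WalkS (adj_mirror ps) IH.
Qed.

Lemma conn_mirror r p q n : conn r (mirror p) (mirror q) n -> conn r p q n.
Proof. by case=> n' nn /walk_mirror; rewrite !mirrorK; exists n'. Qed.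

Definition on_sphere (r : nat) (g : vert) : Prop := in_ball r g /\ ~ in_ball r.-1 g.

Lemma on_sphere_mirror r g : on_sphere r g -> on_sphere r (mirror g).
Proof.
move=> [h1 h2]; split; first exact: in_ball_mirror.
by move/in_ball_mirror; rewrite mirrorK.
Qed.

Lemma on_sphere_box r g : (0 < r)%N -> on_sphere r g ->
  exists m h : int, box m h g /\ 2 * m + 2 * h = r%:Z + `|g.2|.
Proof.
move=> r0 [[m [h [b c]]] n]; exists m, h; split=> //.
case: (lerP (2 * m + 2 * h) (r.-1%:Z + `|g.2|)) => [c'|]; last by ilia.
by case: n; exists m, h.
Qed.

Lemma vertical (S : vert -> Prop) u k n :
  (forall j : int, k <= j <= k + n%:Z -> S (u, j)) -> walk 1 S (u, k) (u, k + n%:Z) n.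
Proof.
elim: n k => [|n IH] k HS; first by rewrite addr0; apply: Walk0; apply: HS; ilia.
have := IH (k + 1); rewrite (_ : k + 1 + n%:Z = k + n.+1%:Z); last by ilia.
move=> w; apply: WalkS (adjU0 _ _) (w _); first by apply: HS; ilia.
by move=> j jk; apply: HS; ilia.
Qed.

(** Seen from the end of a first step [(1, 1)] all heights drop by 1, so [m] becomes [m + 1] and [h]
    becomes [h - 1]. As [m + h] is kept and [|k|] grows by 1, the remaining distance is one less.
    The condition on [u] is the lower bound of the new box. *)
Lemma stepU1 m h u k : box m h (u, k) -> k <= 0 -> 0 < h ->
  1 - (pw h - pw (- m)) <= u -> box (m + 1) (h - 1) ((u - 1) / 2, k - 1).
Proof.
case=> /= m0 h0 lo hi d b1 b2 b3 b4 k0 h1 hu.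
have := pw_le1 k0 => K1; have := pw_gt0 k => K0.
box_tac; first by rewrite dyP dyB // dy1.
all: rewrite ?pwB1 ?pwNS; rlra.
Qed.

Lemma stepU0 m h u k : box m h (u, k) -> k <= 0 -> 0 < h ->
  u <= pw k - 2 + (pw h - pw (- m)) -> box (m + 1) (h - 1) (u / 2, k - 1).
Proof.
case=> /= m0 h0 lo hi d b1 b2 b3 b4 k0 h1 hu.
have := pw_le1 k0 => K1; have := pw_gt0 k => K0.
box_tac; first by rewrite dyP.
all: rewrite ?pwB1 ?pwNS; rlra.
Qed.

Lemma dy_half (m : int) : 1 <= m -> dy m (- (1 / 2)).
Proof. by move=> m1; rewrite dyN (dyW m1) // -[1 in dy 1]/(0 + 1)%R dyP dy1. Qed.

Lemma half_gap (m : int) u : 1 <= m -> dy m u -> - (1 / 2) < u -> - (1 / 2) + pw (- m) <= u.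
Proof. by move=> m1 du; exact: (dy_gap (dy_half m1) du). Qed.

(** The opposite trade, for a first step to [(0, -1)]. The value [- (1 / 2)] is where the other
    downward step leads; the gap at depth [m] turns the strict inequality into the lower bound at
    the top of the new box. *)
Lemma stepD0 m h u k : box m h (u, k) -> 0 <= k -> 1 <= m -> - (1 / 2) < u ->
  box (m - 1) (h + 1) (2 * u, k + 1).
Proof.
case=> /= m0 h0 lo hi d b1 b2 b3 b4 k0 m1 /(half_gap m1 d) hu.
have := pw_ge1 k0 => K1; have := ler_pw hi => KH.
by box_tac; [rewrite dyS|rewrite ?pwS ?pwNB1; rlra..].
Qed.

Lemma stepD0_flat m u k : box m 0 (u, k) -> k < 0 -> - (1 / 2) < u ->
  box (m - 1) 0 (2 * u, k + 1).
Proof.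
case=> /= m0 h0 lo hi d b1 b2 b3 b4 k0.
have m1 : 1 <= m by ilia.
move=> /(half_gap m1 d) hu.
have K1 : 2 * pw k <= 1 by apply: (@ltr_pw k 0).
move: b1 b2 b3 b4; rewrite pw0 => b1 b2 b3 b4.
by box_tac; [rewrite dyS|rewrite ?pwS ?pwNB1 ?pw0; rlra..].
Qed.

(** Descending one step, returning to height 0 and then going to the bottom costs as much as first
    climbing to height 1. So a point with [h = 1] may also have a geodesic which starts downwards,
    within a narrower range of [u]. *)
Lemma stepD0_one m u k : box m 1 (u, k) -> k < 0 -> - (1 / 2) <= u ->
  u <= 1 / 2 + pw k - pw (- m) -> box (m - 1) 1 (2 * u, k + 1).
Proof.
case=> /= m0 h0 lo hi d b1 b2 b3 b4 k0 hu hu'.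
have K1 : 2 * pw k <= 1 by apply: (@ltr_pw k 0).
have Q1 : 2 * pw (- m) <= 1 by apply: (@ltr_pw (- m) 0); ilia.
have E : pw 1 = 2 by []; rewrite E in b1 b2 b3 b4.
by box_tac; [rewrite dyS|rewrite ?pwS ?pwNB1 ?E; rlra..].
Qed.

(** Steps between heights at least 1 contribute even numbers, so the parity of [u] dictates the
    first step. As at the bottom of a box, parity excludes the extreme value that would violate the
    bounds of the smaller box. *)
Lemma stepU_int (i : nat) h u k : (i <= 1)%N -> box 0 h (u, k) -> 1 <= k ->
  dy (-1) (u - i%:R) -> box 0 (h - 1) ((u - i%:R) / 2, k - 1).
Proof.
move=> i1 [/= m0 h0 lo hi d b1 b2 b3 b4] k1 di.
have h1 : 1 <= h by ilia.
have dh : dy (-1) (pw h) by rewrite dy_pw.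
have dk : dy (-1) (pw k) by rewrite dy_pw.
have E : pw (- 0) = 1 by []; rewrite E in b1 b2 b3 b4.
have KH := ler_pw hi; have K2 : 2 <= pw k by rewrite -(mulr1 2); apply: (@ltr_pw 0).
have du : dy 0 ((u - i%:R) / 2) by rewrite (dyP (-1)).
case: i i1 di du => [|[|i]] // _; rewrite ?subr0 => di du.
  have ne : u != pw h - 1.
    by apply/negP => /eqP ?; subst u; apply: (dy_odd dh).
  have : u < pw h - 1 by rewrite lt_neqAle ne; rlra.
  have dR : dy 0 (pw h - 1) by rewrite dyB // ?dy1 // dy_pw.
  move=> /(dy_gap d dR); rewrite E => hu.
  by box_tac => //; rewrite ?pwB1 ?E; rlra.
have ne : u != pw k - 1 - (pw h - 1).
  apply/negP => /eqP Eu; apply: (dy_odd (u := u)) => //.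
  by rewrite Eu (_ : _ - _ = pw k - pw h) ?dyB //; ring.
have : pw k - 1 - (pw h - 1) < u by rewrite lt_neqAle eq_sym ne; rlra.
have dR : dy 0 (pw k - 1 - (pw h - 1)) by rewrite !dyB // ?dy1 // dy_pw //; ilia.
move=> /(dy_gap dR d); rewrite E => hu.
by box_tac => //; rewrite ?pwB1 ?E; rlra.
Qed.

Lemma box_int m h g : box m h g -> 0 <= g.2 -> dy 0 g.1 -> box 0 (h + m) g.
Proof.
by move=> b g0 d; have := box_norm _ _ d b; rewrite subr0; apply=> //; case: b; ilia.
Qed.

(** * Short paths around a missing point *)

Lemma on_sphere_stepD0 r u k : (0 < r)%N -> on_sphere r (u, k) -> 0 <= k -> ~~ dy 0 u ->
  - (1 / 2) < u -> in_ball r.-1 (2 * u + 0%:R, k + 1).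
Proof.
move=> r0 /(on_sphere_box r0)[m [h [b c]]] k0 nd hu; rewrite addr0.
have m1 : 1 <= m.
  case: (lerP 1 m) => // m0; case/negP: nd; have := box_dy b.
  by rewrite (_ : m = 0) //; case: (b); ilia.
apply: box_in_ball (stepD0 b k0 m1 hu) _; move: c; rewrite /=; ilia.
Qed.

Lemma dy_shift u v : dy 0 v -> dy 0 (u + v) = dy 0 u.
Proof.
move=> dv; apply/idP/idP => du; last exact: dyD.
by rewrite -[u](addrK v) dyB.
Qed.

Lemma dy_shiftB u v : dy 0 v -> dy 0 (u - v) = dy 0 u.
Proof. by move=> dv; rewrite dy_shift // dyN. Qed.

Lemma pwM1 : pw (-1) = 1 / 2. Proof. by []. Qed.

Lemma in_ball_half : in_ball 2 (1 / 2, 0).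
Proof.
apply: (@in_ball_adj 1 (0, -1)); first by have := @in_ballD 0 isT; rewrite mul0r oppr0.
by have := adjU1 0 (-1); rewrite pwM1 add0r.
Qed.

Lemma in_ball_mhalf : in_ball 2 (- (1 / 2), 0).
Proof. by apply: (in_ball_adj (@in_ballD 1 isT)); exact: (adjU0 _ (-1)). Qed.

(* The two points have geodesics through [(1 / 2, 0)] and [(- 1 / 2, 0)], which are at
   distance 2. *)
Lemma opposite_up r (k : int) : (9 <= r)%N ->
  on_sphere r (pw k - 1 / 2, k) -> on_sphere r (- (1 / 2), k) -> 0 <= k ->
  conn r (pw k - 1 / 2, k) (- (1 / 2), k) (2 * r - 2).
Proof.
move=> r9 sa sb k0; have [oka _] := sa; have [okb _] := sb.
have [|m [h [b c]]] := on_sphere_box _ sb; first by ilia.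
have m1 : 1 <= m.
  case: (lerP 1 m) => // m0; have := box_dy b; rewrite (_ : m = 0); last by case: (b); ilia.
  by have /negP := dy_pw_odd 1; rewrite dyN.
have [n en] : exists n : nat, n%:Z = k by exists (absz k); ilia.
have kr : (n.+1 < r)%N by move: c; case: b => /=; ilia.
have K1 := pw_ge1 k0.
have bx : box 0 k (pw k - 1, k) /\ box 0 k (0, k).
  have p00 : pw (- 0) = 1 by [].
  split; box_tac.
  - by rewrite dyB ?dy1 ?dy_pw //; ilia.
  - by rlra.
  - by rlra.
  - by rlra.
  - by rlra.
  - exact: (@dy_nat 0 0).
  - by rlra.
  - by rlra.
  - by rlra.
  - by rlra.
have okn x : box 0 k (x, k) -> in_ball n (x, k) by move/box_in_ball; apply; rewrite /=; ilia.
have c1 : conn r (pw k - 1 / 2, k) (1 / 2, 0) n.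
  apply: conn_sym; apply: (conn_geo in_ball_half) => //; last by ilia.
  rewrite tr_iv0; apply: okn; rewrite (_ : _ - _ = pw k - 1); first by case: bx.
  by field.
have c2 : conn r (- (1 / 2), 0) (- (1 / 2), k) n.
  apply: (conn_geo in_ball_mhalf) => //; last by ilia.
  by rewrite tr_iv0; apply: okn; rewrite subrr; case: bx.
have a1 := adjU0 (1 / 2) 0; have a2 := adjU1 (- (1 / 2)) 0.
rewrite (_ : - (1 / 2) + pw 0 = 1 / 2) in a2; last by rewrite pw0; field.
have o1 := in_ball_half; have o2 := in_ball_mhalf; have o3 := in_ball_adj o1 a1.
have c3 : conn r (1 / 2, 0) (- (1 / 2), 0) 2.
  apply: (@conn_trans _ _ (1 / 2, 0 + 1) _ 1 1); apply: conn1.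
  - by apply: in_ballW o1; ilia.
  - by apply: in_ballW o3; ilia.
  - exact: a1.
  - by apply: in_ballW o3; ilia.
  - by apply: in_ballW o2; ilia.
  - exact: adj_sym a2.
by apply: connW (conn_trans c1 (conn_trans c3 c2)); ilia.
Qed.

Definition detour r (a b : vert) : Prop := on_sphere r a -> on_sphere r b -> conn r a b (2 * r - 2).

Lemma detour_sym r a b : detour r a b -> detour r b a.
Proof. by move=> g sb sa; apply: conn_sym; apply: g. Qed.

Lemma detour_mirror r a b : detour r (mirror a) (mirror b) -> detour r a b.
Proof. by move=> g sa sb; apply/conn_mirror/g; apply: on_sphere_mirror. Qed.

Lemma detour_pairs r u k :
  detour r (u, k + 1) (u + pw k, k + 1) ->
  detour r (u, k - 1) (u - pw (k - 1), k - 1) ->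
  (forall i j : nat, (i <= 1)%N -> (j <= 1)%N ->
    detour r (u + i%:R * pw k, k + 1) (u - j%:R * pw (k - 1), k - 1)) ->
  forall a b, adj 1 (u, k) a -> adj 1 (u, k) b -> detour r a b.
Proof.
move=> guu gdd gud.
have nbr a : adj 1 (u, k) a -> exists2 i : nat, (i <= 1)%N &
    a = (u + i%:R * pw k, k + 1) \/ a = (u - i%:R * pw (k - 1), k - 1).
  case=> -[i i1]; first by rewrite upvP => ->; exists i => //; left.
  case: a => v l; rewrite upvP => -[-> ->]; exists i => //.
  by right; rewrite !addrK.
have grefl x : detour r x x by move=> [ox _] _; exists 0 => //; exact: Walk0.
have i01 i : (i <= 1)%N -> i = 0 \/ i = 1 by case: i => [|[|i]] // _; [left|right].
move=> a b /nbr[i i1 ha] /nbr[j j1 hb].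
case: ha hb => -> [] ->; [| exact: gud | exact/detour_sym/gud |].
  by case: (i01 i i1) (i01 j j1) => -> [] ->; rewrite ?mul0r ?addr0 ?mul1r //; apply: detour_sym.
by case: (i01 i i1) (i01 j j1) => -> [] ->; rewrite ?mul0r ?subr0 ?mul1r //; apply: detour_sym.
Qed.

(** * Midpoint above height 0 *)

Lemma detour_D0 r v w (l l' : int) : (0 < r)%N -> 0 <= l -> 0 <= l' -> ~~ dy 0 v -> ~~ dy 0 w ->
  - (1 / 2) < v -> - (1 / 2) < w -> detour r (v, l) (w, l').
Proof.
move=> r0 l0 l'0 nv nw hv hw sa sb; have [oka _] := sa; have [okb _] := sb.
by apply: (@commonD 0) => //; apply: on_sphere_stepD0.
Qed.

(** A coordinate that is not integral forces depth at least 1, so a first step to [(0, -1)] serves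
    every neighbour strictly to the right of [- (1 / 2)]. Only the neighbour [u - 2 ^ (k - 1)] can
    fail this, by equality, and then [u] lies on the axis [2 * u = 2 ^ k - 1] of [mirror]. *)
Lemma above_frac r u (k : int) a b : (9 <= r)%N -> pw k - 1 <= 2 * u -> 1 <= k ->
  ~~ dy 0 u -> adj 1 (u, k) a -> adj 1 (u, k) b ->
  detour r a b.
Proof.
move=> r9 z0 k1 nu.
have K2 : 2 <= pw k by rewrite -(mulr1 2); apply: (@ltr_pw 0).
have dk : dy 0 (pw k) by rewrite dy_pw //; ilia.
have dk1 : dy 0 (pw (k - 1)) by rewrite dy_pw //; ilia.
have di (i : nat) : (i <= 1)%N -> dy 0 (i%:R * pw k) /\ 0 <= i%:R * pw k <= pw k.
  case: i => [|[|i]] // _; rewrite ?mul0r ?mul1r; split=> //; rlra.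
have P1 : pw (k - 1) = pw k / 2 by rewrite pwB1.
apply: detour_pairs.
- by apply: detour_D0; [ilia|ilia|ilia|exact: nu|rewrite dy_shift; [exact: nu|exact: dk]|rlra|rlra].
- have [lt|ge] := ltrP (- (1 / 2)) (u - pw (k - 1)).
    by apply: detour_D0; [ilia|ilia|ilia|exact: nu|rewrite dy_shiftB; [exact: nu|exact: dk1]|rlra|rlra].
  have -> : u - pw (k - 1) = - (1 / 2) by rlra.
  have -> : u = pw (k - 1) - 1 / 2 by rlra.
  by move=> sa sb; apply: opposite_up => //; ilia.
move=> i j i1 j1; have [d1 /andP[p1 p2]] := di i i1.
have [lt|ge] := ltrP (- (1 / 2)) (u - j%:R * pw (k - 1)).
  have dj : dy 0 (j%:R * pw (k - 1)).
    by case: j j1 {lt} => [|[|j]] // _; rewrite ?mul0r ?mul1r //; exact: (@dy_nat 0 0).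
  by apply: detour_D0; [ilia|ilia|ilia|rewrite dy_shift; [exact: nu|exact: d1]
     |rewrite dy_shiftB; [exact: nu|exact: dj]|rlra|rlra].
have ej : j%:R * pw (k - 1) = pw (k - 1).
  by case: j j1 ge => [|[|j]] // _; rewrite ?mul0r ?mul1r // => ge; exfalso; rlra.
rewrite ej in ge *.
have eu : u = (pw k - 1) / 2 by rlra.
have E1 : pw (k + 1) - 1 - (u + i%:R * pw k) = u + (pw k - i%:R * pw k).
  by rewrite pwS eu; field.
have E2 : pw (k - 1) - 1 - (u - pw (k - 1)) = u by rewrite P1 eu; field.
(* The reflection fixes the midpoint and moves the lower neighbour from [- (1 / 2)] to [u], while
   the upper one stays to the right of [- (1 / 2)]. *)
apply: detour_mirror; rewrite /mirror /= E1 E2.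
by apply: detour_D0; [ilia|ilia|ilia|rewrite dy_shift; [exact: nu|exact: dyB]|exact: nu|rlra|rlra].
Qed.

(* [u] is odd exactly when geodesics from the origin start with [(1, 1)]. *)
Lemma detour_parity r v w (l l' : int) : (0 < r)%N -> 1 <= l -> 1 <= l' -> dy 0 v -> dy (-1) (w - v) ->
  detour r (v, l) (w, l').
Proof.
move=> r0 l1 l'1 dv dwv sa sb; have [oka _] := sa; have [okb _] := sb.
have dw : dy 0 w by rewrite -[w](subrK v) dyD //; apply: (@dyW (-1)).
have [i i1 di] : exists2 i : nat, (i <= 1)%N & dy (-1) (v - i%:R).
  by case/orP: (dy0_parity dv) => h; [exists 0; rewrite ?subr0|exists 1].
have [|m [h [b c]]] := on_sphere_box _ sa; first by ilia.
have [|m' [h' [b' c']]] := on_sphere_box _ sb; first by ilia.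
apply: (commonU i1) => //.
  have := stepU_int i1 (box_int b _ dv) l1 di => /(_ _)/box_in_ball; apply; first by rewrite /=; ilia.
  by move: c; rewrite /=; ilia.
have di' : dy (-1) (w - i%:R).
  by rewrite -(subrK v w) -addrA dyD.
have := stepU_int i1 (box_int b' _ dw) l'1 di' => /(_ _)/box_in_ball; apply; first by rewrite /=; ilia.
by move: c'; rewrite /=; ilia.
Qed.

(** From [k = 2] on, the neighbours have height at least 1 and differ by even numbers, so they share
    the first step. *)
Lemma above_int r u (k : int) a b : (0 < r)%N -> 2 <= k -> dy 0 u -> adj 1 (u, k) a -> adj 1 (u, k) b ->
  detour r a b.
Proof.
move=> r0 k2 du.
have dk : dy (-1) (pw k) by rewrite dy_pw //; ilia.
have dk1 : dy (-1) (pw (k - 1)) by rewrite dy_pw //; ilia.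
have d0 : dy (-1) 0 by rewrite /dy mul0r.
have di (i : nat) l : (i <= 1)%N -> dy (-1) (pw l) -> dy (-1) (i%:R * pw l).
  by case: i => [|[|i]] // _ dl; rewrite ?mul0r ?mul1r.
apply: detour_pairs.
- by apply: detour_parity; [exact: r0|ilia|ilia|exact: du|rewrite addrC addKr].
- by apply: detour_parity; [exact: r0|ilia|ilia|exact: du|rewrite addrC addKr dyN].
move=> i j i1 j1.
have dik := di i k i1 dk; have djk := di j (k - 1) j1 dk1.
apply: detour_parity; [exact: r0|ilia|ilia|rewrite dyD //; exact: (@dyW (-1))|].
by rewrite addrAC opprD addrA subrr sub0r addrC dyB ?dyN.
Qed.

Lemma stepU1_ok (r : nat) m h u k : (0 < r)%N -> box m h (u, k) ->
  2 * m + 2 * h = r%:Z + `|k| -> k <= 0 -> 0 < h ->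
  1 - (pw h - pw (- m)) <= u -> in_ball r.-1 ((u - 1%:R) / 2, k - 1).
Proof.
move=> r0 b c k0 h1 hu; apply: box_in_ball (stepU1 b k0 h1 hu) _; rewrite /=; ilia.
Qed.

Lemma stepU0_ok (r : nat) m h u k : (0 < r)%N -> box m h (u, k) ->
  2 * m + 2 * h = r%:Z + `|k| -> k <= 0 -> 0 < h ->
  u <= pw k - 2 + (pw h - pw (- m)) -> in_ball r.-1 ((u - 0%:R) / 2, k - 1).
Proof.
move=> r0 b c k0 h1 hu; rewrite subr0.
by apply: box_in_ball (stepU0 b k0 h1 hu) _; rewrite /=; ilia.
Qed.

Lemma stepD0_flat_ok (r : nat) m u k : (0 < r)%N -> box m 0 (u, k) ->
  2 * m = r%:Z + `|k| -> k <= 0 -> - (1 / 2) < u ->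
  in_ball r.-1 (2 * u + 0%:R, k + 1).
Proof.
move=> r0 b c k0 hu; rewrite addr0; have [e|ne] := eqVneq k 0.
  subst k; have m1 : 1 <= m by ilia.
  by apply: box_in_ball (stepD0 b _ m1 hu) _; rewrite //=; ilia.
have k1 : k < 0 by ilia.
by apply: box_in_ball (stepD0_flat b k1 hu) _; rewrite /=; ilia.
Qed.

Lemma stepD0_one_ok (r : nat) m u k : (0 < r)%N -> box m 1 (u, k) ->
  2 * m + 2 = r%:Z + `|k| -> k < 0 -> - (1 / 2) <= u ->
  u <= 1 / 2 + pw k - pw (- m) -> in_ball r.-1 (2 * u + 0%:R, k + 1).
Proof.
move=> r0 b c k0 hu hu'; rewrite addr0.
by apply: box_in_ball (stepD0_one b k0 hu hu') _; rewrite /=; ilia.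
Qed.

Lemma bit01 (i : nat) : (i <= 1)%N -> i%:R = 0 :> rat \/ i%:R = 1 :> rat.
Proof. by case: i => [|[|i]] // _; [left|right]. Qed.

(** The digits of [2 ^ h - 1] are all 1, while the even number [2 ^ h + 2 * i] asks for a first step
    [(0, 1)]. The path leaves the geodesic to the lower point at [(3, 2)] and drops to [(3, 0)].
    From there the upper point is reached over a peak of height [h] instead of [h + 1], which pays
    for the drop. *)
Lemma above_one_corner r (h : int) i : (9 <= r)%N -> 2 * h = r%:Z -> (i <= 1)%N ->
  in_ball r (pw h + i%:R * 2, 2) -> in_ball r (pw h - 1, 0) ->
  conn r (pw h + i%:R * 2, 2) (pw h - 1, 0) (2 * r - 2).
Proof.
move=> r9 hr i1 oka okb.
have pE : [/\ pw 1 = 2, pw 2 = 4 & pw 3 = 8] by [].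
have [p1 p2 p3] := pE; have pm0 : pw (- 0) = 1 by [].
have pm2 : pw (- 2%:Z) = 1 / 4 by [].
have pm2' : pw (-2) = 1 / 4 by [].
have h3 : pw h = 8 * pw (h - 3) by rewrite -p3 -pwD; congr pw; ring.
have h2 : pw h = 4 * pw (h - 2) by rewrite -p2 -pwD; congr pw; ring.
have g3 : 4 <= pw (h - 3) by rewrite -p2; apply: ler_pw; ilia.
have i01 := bit01 i1.
have dh j : 0 <= j -> dy 0 (pw j) by move=> j0; rewrite dy_pw.
have d2i : dy 0 (i%:R * 2) by rewrite -natrM; exact: (@dy_nat 0).
have dn (n : nat) : dy 0 n%:R by exact: (@dy_nat 0).
have a1 := adjU1 0 0; have a2 := adjU1 1 1; have a3 := adjU0 3 1; have a4 := adjU0 3 0.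
rewrite ?pw0 ?p1 ?add0r in a1 a2 a3 a4.
rewrite (_ : 1 + 2 = 3) in a2; last by ring.
have o1 := in_ball_adj in_ball0 a1; have o2 := in_ball_adj o1 a2.
have o3 := in_ball_adj o2 (adj_sym a3); have o4 := in_ball_adj o3 (adj_sym a4).
have c1 : conn r (3, 1 + 1) (pw h - 1, 0) (r - 2).
  apply: (conn_geo o2); [|by ilia|exact: okb].
  rewrite /tr /iv /= (_ : (1 + 1) = 2 :> int) // (_ : _ + _ = pw (h - 2) - 1); last first.
    by rewrite h2 pm2; field.
  rewrite addr0; apply: (@box_in_ball 2 (h - 2)); last by rewrite /=; ilia.
  by box_tac; [apply: dyB; [apply: dy_pw; ilia|exact: dy1]|rewrite ?pm2 ?pm2'; rlra..].
have c2 : conn r (3, 1 + 1) (3, 0) 2.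
  by apply: (conn_trans (n := 1) (n' := 1) (q := (3, 1))); apply: conn1;
    first [exact: adj_sym a3|exact: adj_sym a4|apply: in_ballW o2; ilia|apply: in_ballW o3; ilia|apply: in_ballW o4; ilia].
have oka' : in_ball r (pw h + i%:R * 2, 3).
  apply: (@box_in_ball 0 (h + 1)); last by rewrite /=; ilia.
  by box_tac; [apply: dyD; [apply: dh; ilia|exact: d2i]|rewrite ?pwS ?p3 ?pm0; case: i01 => ->; rlra..].
have c3 : conn r (3, 0) (pw h + i%:R * 2, 3) (r - 3).
  apply: (conn_geo o4); [|by ilia|exact: oka'].
  rewrite tr_iv0; apply: (@box_in_ball 0 h); last by rewrite /=; ilia.
  by box_tac; [apply: dyB (dn 3); apply: dyD; [apply: dh; ilia|exact: d2i]|rewrite ?p3 ?pm0; case: i01 => ->; rlra..].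
have c4 : conn r (pw h + i%:R * 2, 3) (pw h + i%:R * 2, 2) 1.
  by apply: conn1; [exact: oka'|exact: oka|exact: adj_sym (adjU0 _ _)].
have := conn_trans (conn_trans (conn_trans (conn_sym c1) c2) c3) c4.
by move/conn_sym; apply: connW; ilia.
Qed.

Lemma above_one r u a b : (9 <= r)%N -> 1 <= 2 * u -> dy 0 u ->
  adj 1 (u, 1) a -> adj 1 (u, 1) b -> detour r a b.
Proof.
move=> r9 z0 du.
have r0 : (0 < r)%N by ilia.
have p1 : pw 1 = 2 by []; have pm0 : pw (- 0) = 1 by [].
have u1 : 1 <= u by have := dy_ge du; rewrite pm0; apply; rlra.
have d2 : dy (-1) 2 by exact: (@dy_pw (-1) 1).
apply: detour_pairs; rewrite ?subrr ?pw0 ?p1.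
- by apply: detour_parity => //; rewrite addrC addKr.
- have du1 : dy 0 (u - 1) by rewrite dyB ?dy1.
  move=> sa sb; have [oka _] := sa; have [okb _] := sb.
  have [m [h [b1 c1]]] := on_sphere_box r0 sa; have [m' [h' [b1' c1']]] := on_sphere_box r0 sb.
  have {}b1 := box_int b1 isT du; have {}b1' := box_int b1' isT du1.
  have H1 : 2 <= pw (h + m) by rewrite -p1; apply: ler_pw; move: c1; rewrite /=; ilia.
  have H1' : 2 <= pw (h' + m') by rewrite -p1; apply: ler_pw; move: c1'; rewrite /=; ilia.
  apply: (@commonU 1) => //.
    by apply: (stepU1_ok r0 b1) => //; rewrite ?pm0; (move: c1; rewrite /=; ilia) || rlra.
  by apply: (stepU1_ok r0 b1') => //; rewrite ?pm0; (move: c1'; rewrite /=; ilia) || rlra.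
move=> i j i1 j1 sa sb; have [oka _] := sa; have [okb _] := sb.
have j01 := bit01 j1.
have dj : dy 0 (u - j%:R * 1) by rewrite mulr1 dyB // dy_nat.
have di : dy 0 (u + i%:R * 2) by rewrite -natrM dyD // dy_nat.
have dii : dy (-1) (i%:R * 2).
  by case: i i1 {sa oka di} => [|[|i]] // _; rewrite ?mul0r ?mul1r // /dy mul0r.
have [m [h [b1 c1]]] := on_sphere_box r0 sa; have [m' [h' [b1' c1']]] := on_sphere_box r0 sb.
have {}b1 := box_int b1 isT di; have {}b1' := box_int b1' isT dj.
have H1' : 2 <= pw (h' + m') by rewrite -p1; apply: ler_pw; move: c1'; rewrite /=; ilia.
have par (i0 : nat) : (i0 <= 1)%N -> dy (-1) (u - i0%:R) ->
    in_ball r.-1 ((u + i%:R * 2 - i0%:R) / 2, 1 + 1 - 1).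
  move=> i01 d; apply: box_in_ball (stepU_int i01 b1 _ _) _ => //.
    by rewrite addrAC dyD.
  by move: c1; rewrite /=; ilia.
case/orP: (dy0_parity du) => hu; last first.
  apply: (@commonU 1) => //; first exact: par.
  apply: (stepU1_ok r0 b1'); [move: c1'; rewrite /=; ilia|by []|move: c1'; rewrite /=; ilia|].
  by rewrite ?pm0; case: j01 => ->; rlra.
(* For even [u] the step [(0, 1)] fails for the lower point only at the extreme value
   [2 ^ (h' + m') - 1]. This is odd, so [j = 1] and [u = 2 ^ (h' + m')]: the corner. *)
have [lt|ge] := lerP (u - j%:R * 1) (pw (h' + m') - 2).
  apply: (@commonU 0) => //; first by apply: par; rewrite ?subr0.
  apply: (stepU0_ok r0 b1'); [move: c1'; rewrite /=; ilia|by []|move: c1'; rewrite /=; ilia|].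
  by rewrite ?pm0 ?pw0; rlra.
have dh : dy (-1) (pw (h' + m')) by rewrite dy_pw //; move: c1'; rewrite /=; ilia.
have dh0 : dy 0 (pw (h' + m') - 2) by rewrite (@dyW (-1)) // dyB.
have E : u - j%:R * 1 = pw (h' + m') - 1.
  have := dy_gap dh0 dj ge; have := box_1 b1'; rewrite /= pm0; rlra.
have ej : j%:R = 1 :> rat.
  case: j01 => // ej; move: E; rewrite ej mul0r subr0 => E.
  by case: (@dy_odd (pw (h' + m'))) => //; rewrite -E.
have eu : u = pw (h' + m') by move: E; rewrite ej; rlra.
move: oka okb; rewrite ej mulr1 eu => oka okb.
by apply: above_one_corner => //; move: c1'; rewrite /=; ilia.
Qed.

(** * Midpoint at height 0 *)

Lemma tr_ivE (x u : rat) (k : int) : (u, k) = tr (x, 0) (u - x, k).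
Proof. by rewrite tr_0 /= addrCA subrr addr0. Qed.

Lemma box00_eq q : box 0 q.2 q -> q.2 = 0 -> q = (0, 0).
Proof. by case: q => u k /= b e; subst k; rewrite (box00 b). Qed.

Lemma conn_down r x u (h : int) n : n%:Z = h -> box 0 h (u - x, h) -> in_ball r (u, h) ->
  in_ball r (x, 0) ->
  (forall v (j : int), 0 < j < h -> dy 0 v -> 0 <= v <= pw j - 1 -> in_ball r (x + v, j)) ->
  conn r (u, h) (x, 0) n.
Proof.
move=> nh b oku okx H.
have [||v [n' [bv en w]]] := @from_top (fun q => in_ball r (tr (x, 0) q)) 0 h (u - x) b.
- by rewrite -tr_ivE.
- move=> [v j] bv /andP[/= j0 jh]; rewrite tr_0 /=.
  have [e|ne] := eqVneq j 0.
    by have := box00_eq bv e => -[-> ->]; rewrite addr0.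
  case: bv => /= _ _ _ _ d b1 _ _ b4.
  have pm0 : pw (- 0) = 1 by [].
  apply: H d _; first by rewrite lt_neqAle eq_sym ne j0.
  by apply/andP; split; move: b1 b4; rewrite pm0; rlra.
rewrite (box00 bv) in w.
rewrite (_ : n = n'); last by ilia.
apply: walk_conn; apply: walk_frame.
by move: w; rewrite tr_iv0.
Qed.

Lemma conn_vertical r u (k h : int) n : n%:Z = h - k ->
  (forall j : int, k <= j <= h -> in_ball r (u, j)) -> conn r (u, k) (u, h) n.
Proof.
move=> e H; rewrite (_ : h = k + n%:Z); last by ilia.
by apply: walk_conn; apply: vertical => j jk; apply: H; ilia.
Qed.

(* Both points are reached by passing over [2 ^ (h - 1) - 1]; this takes the full height [h]
   for only one of them. *)
Lemma level_up_int r u : (9 <= r)%N -> 0 <= u -> dy 0 u -> ~ in_ball r (u, 0) ->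
  detour r (u, 1) (u + 1, 1).
Proof.
move=> r9 u0 du nc sa sb; have [oka _] := sa; have [okb _] := sb.
have r0 : (0 < r)%N by ilia.
have pm0 : pw (- 0) = 1 by [].
have p1 : pw 1 = 2 by [].
have du1 : dy 0 (u + 1) by rewrite dyD // dy1.
have [m' [h' [b c]]] := on_sphere_box r0 sb.
have {}b := box_int b isT du1.
have [h eh] : exists h : int, h = h' + m' by exists (h' + m').
rewrite -eh in b; have {c eh m' h'} c : 2 * h = r%:Z + 1 by move: c; rewrite /=; ilia.
have hb := box_1 b; rewrite /= pm0 in hb.
have dh1 : dy 0 (pw (h - 1)) by rewrite dy_pw //; ilia.
have h1 : pw h = 2 * pw (h - 1) by rewrite -pwS; congr pw; ring.
have h2 : pw (h - 1) = 2 * pw (h - 2) by rewrite -pwS; congr pw; ring.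
have g2 : 2 <= pw (h - 2) by rewrite -p1; apply: ler_pw; ilia.
(* Otherwise the midpoint [(u, 0)] would be in the ball, over a peak of height [h - 1]. *)
have lo : pw (h - 1) <= u.
  have lt : pw (h - 1) - 1 < u.
    rewrite ltNge; apply/negP => le; apply: nc; apply: (@box_in_ball 0 (h - 1)); last by rewrite /=; ilia.
    by box_tac; [exact: du|rewrite ?pw0 ?pm0; rlra..].
  have dd : dy 0 (pw (h - 1) - 1) by rewrite dyB // dy1.
  by have := dy_gap dd du lt; rewrite pm0; rlra.
have okv v (j : int) : dy 0 v -> 1 <= j <= h -> 0 <= v <= pw h - 1 -> in_ball r (v, j).
  move=> dv /andP[j1 jh] /andP[v0 v1]; apply: (@box_in_ball 0 h); last by rewrite /=; ilia.
  have J1 : 1 <= pw j by apply: pw_ge1; ilia.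
  have JH := ler_pw jh.
  by box_tac; [exact: dv|rewrite ?pm0; rlra..].
have okw : in_ball r (pw (h - 1) - 1, 0).
  apply: (@box_in_ball 0 (h - 1)); last by rewrite /=; ilia.
  by box_tac; [rewrite dyB // dy1|rewrite ?pw0 ?pm0; rlra..].
have dw : dy 0 (pw (h - 1) - 1) by rewrite dyB // dy1.
have okwv v (j : int) : 0 < j < h -> dy 0 v -> 0 <= v <= pw j - 1 ->
    in_ball r (pw (h - 1) - 1 + v, j).
  move=> /andP[j0 jh] dv /andP[v0 v1]; apply: okv; [exact: dyD|ilia|].
  by have := ltr_pw jh; rlra.
have [n en] : exists n : nat, n%:Z = h by exists (absz h); ilia.
have n1 : n.+2%:Z = h + 2 by ilia.
have c1 : conn r (u + 1, 1) (u + 1, h) n.-1.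
  by apply: conn_vertical; [ilia|move=> j jh; apply: okv; [exact: du1|ilia|rlra]].
have c2 : conn r (u + 1, h) (pw (h - 1) - 1, 0) n.
  apply: conn_down; [exact: en| |by apply: okv; [exact: du1|ilia|rlra]|exact: okw|exact: okwv].
  by box_tac; [exact: dyB|rewrite ?pm0; rlra..].
have c3 : conn r (u, 1) (u, h - 1) n.-2.
  by apply: conn_vertical; [ilia|move=> j jh; apply: okv; [exact: du|ilia|rlra]].
have c4 : conn r (u, h - 1) (pw (h - 1) - 1, 0) n.-1.
  apply: conn_down; [ilia| |by apply: okv; [exact: du|ilia|rlra]|exact: okw|].
    by box_tac; [exact: dyB|rewrite ?pm0; rlra..].
  by move=> v j jh; apply: okwv; ilia.
(* The length is [(h - 2) + (h - 1) + h + (h - 1) = 4 * h - 4 = 2 * r - 2], as [2 * h = r + 1]. *)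
have := conn_trans (conn_trans c3 c4) (conn_sym (conn_trans c1 c2)).
by apply: connW; ilia.
Qed.

Lemma pw_lt1 (h : int) : 0 < h -> 2 <= pw h.
Proof. by move=> h0; rewrite -(mulr1 2); apply: (@ltr_pw 0). Qed.

(** Both boxes have the same [m + h], and subtracting [1 / 2] is compatible with any depth from 1
    on. If one of them has positive height, the other can be normalised to have it too, and both
    geodesics start with [(1, 1)]; otherwise both start downwards. *)
Lemma level_down r (u : rat) : (9 <= r)%N -> 0 <= u ->
  detour r (u, -1) (u - 1 / 2, -1).
Proof.
move=> r9 u0 sa sb; have [oka noka] := sa; have [okb _] := sb.
have r0 : (0 < r)%N by ilia.
have pm1 : pw (-1) = 1 / 2 by [].
have d12 (m : int) : 1 <= m -> dy m (1 / 2) by move=> m1; rewrite -dyN dy_half.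
have [m [h [b c]]] := on_sphere_box r0 sa; have [m' [h' [b' c']]] := on_sphere_box r0 sb.
have m1 : 1 <= m by have := box_lo b; rewrite /=; ilia.
have m1' : 1 <= m' by have := box_lo b'; rewrite /=; ilia.
have h0 := box_h b; have h0' := box_h b'.
have d : dy m u by exact: box_dy b.
have d' : dy m' (u - 1 / 2) by exact: box_dy b'.
have Q1 : pw (- m) <= 1 / 2 by rewrite -pm1; apply: ler_pw; ilia.
have both m2 h2 m3 h3 : box m2 h2 (u, -1) -> box m3 h3 (u - 1 / 2, -1) ->
    m2 + h2 = m + h -> m3 + h3 = m + h -> 1 <= m2 -> 1 <= m3 -> 1 <= h2 -> 1 <= h3 ->
    conn r (u, -1) (u - 1 / 2, -1) (2 * r - 2).
  move=> b2 b3 e2 e3 m20 m30 h20 h30.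
  have Q2 : pw (- m2) <= 1 / 2 by rewrite -pm1; apply: ler_pw; ilia.
  have Q3 : pw (- m3) <= 1 / 2 by rewrite -pm1; apply: ler_pw; ilia.
  have H2 : 2 <= pw h2 by apply: pw_lt1; ilia.
  have H3 : 2 <= pw h3 by apply: pw_lt1; ilia.
  apply: (@commonU 1); [by []|exact: r0|exact: oka|exact: okb| |].
    apply: (stepU1_ok r0 b2); [move: c; rewrite /=; ilia|by []|ilia|rlra].
  apply: (stepU1_ok r0 b3); [move: c; rewrite /=; ilia|by []|ilia|rlra].
have cc : m + h = m' + h' by move: c c'; rewrite /=; ilia.
have [h1|h1] := lerP 1 h'.
  have [h2|h2] := lerP 1 h; first by apply: (both _ _ _ _ b b'); ilia.
  have du : dy m' u by rewrite -[u](subrK (1 / 2)) dyD // d12.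
  have nb := @box_norm m m' h (u, -1) _ _ du b.
  apply: (both _ _ _ _ (nb _ _) b'); rewrite /=; ilia.
have [h2|h2] := lerP 1 h.
  have du : dy m (u - 1 / 2) by rewrite dyB // d12.
  have nb := @box_norm m' m h' (u - 1 / 2, -1) _ _ du b'.
  apply: (both _ _ _ _ b (nb _ _)); rewrite /=; ilia.
have eh : h = 0 by ilia.
have eh' : h' = 0 by ilia.
subst h h'.
(* Strictness puts [u - 1 / 2] to the right of [- (1 / 2)]. *)
have lt : 0 < u.
  rewrite lt_neqAle u0 andbT; apply/negP => /eqP e; apply: noka.
  by apply: (@in_ballW 1) => //; [ilia|rewrite -e; have := @in_ballD 0 isT; rewrite mul0r oppr0].
apply: (@commonD 0); [by []|exact: r0|exact: oka|exact: okb| |].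
  apply: (stepD0_flat_ok r0 b); [move: c; rewrite /=; ilia|by []|rlra].
apply: (stepD0_flat_ok r0 b'); [move: c'; rewrite /=; ilia|by []|rlra].
Qed.

(** With depths normalised to 0 and 1, the parity of [u + i] chooses the first step. An even value
    could only cause trouble for [u = 2 ^ H - 1], but then the midpoint [(u, 0)] would be in the
    ball. *)
Lemma level_mixed_int r (u : rat) (i j : nat) : (9 <= r)%N -> (i <= 1)%N -> (j <= 1)%N ->
  0 <= u -> dy 0 u -> ~ in_ball r (u, 0) ->
  detour r (u + i%:R, 1) (u - j%:R * (1 / 2), -1).
Proof.
move=> r9 i1 j1 u0 du nc sa sb; have [oka _] := sa; have [okb _] := sb.
have r0 : (0 < r)%N by ilia.
have pm0 : pw (- 0) = 1 by [].
have pm1 : pw (-1) = 1 / 2 by [].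
have pm1' : pw (- 1%:Z) = 1 / 2 by [].
have j01 := bit01 j1.
have d12 : dy 1 (1 / 2) by rewrite -dyN dy_half.
have di : dy 0 (u + i%:R) by rewrite dyD // dy_nat.
have dj : dy 1 (u - j%:R * (1 / 2)).
  apply: dyB; first exact: (@dyW 0).
  by case: j01 => ->; rewrite ?mul1r ?mul0r //; exact: (@dy_nat 1 0).
have [m [h [b1 c1]]] := on_sphere_box r0 sa; have [m' [h' [b1' c1']]] := on_sphere_box r0 sb.
have {}b1 := box_int b1 isT di.
have m1' : 1 <= m' by have := box_lo b1'; rewrite /=; ilia.
have {}b1' : box 1 (h' + (m' - 1)) (u - j%:R * (1 / 2), -1).
  by apply: box_norm b1' => //; rewrite m1'.
have [H eH] : exists H : int, H = h' + (m' - 1) by exists (h' + (m' - 1)).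
rewrite -eH in b1'.
have {eH c1' m1' m' h'} c1' : 2 + 2 * H = r%:Z + 1 by move: c1'; rewrite /=; ilia.
have H2 : 2 <= pw H by apply: pw_lt1; ilia.
have par (i0 : nat) : (i0 <= 1)%N -> dy (-1) (u + i%:R - i0%:R) ->
    in_ball r.-1 ((u + i%:R - i0%:R) / 2, 1 - 1).
  move=> i01 d; apply: box_in_ball (stepU_int i01 b1 _ d) _ => //.
  by move: c1; rewrite /=; ilia.
case/orP: (dy0_parity di) => hu; last first.
  apply: (@commonU 1); [by []|exact: r0|exact: oka|exact: okb|exact: par|].
  apply: (stepU1_ok r0 b1'); [rewrite /=; ilia|by []|ilia|].
  by rewrite ?pm1 ?pm1'; case: j01 => ->; rlra.
have [lt|ge] := lerP (u - j%:R * (1 / 2)) (pw H - 2).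
  apply: (@commonU 0); [by []|exact: r0|exact: oka|exact: okb|by apply: par; rewrite ?subr0|].
  apply: (stepU0_ok r0 b1'); [rewrite /=; ilia|by []|ilia|].
  by rewrite ?pm1 ?pm1'; rlra.
have dH : dy 0 (pw H) by rewrite dy_pw //; ilia.
have lo : pw H - 1 <= u.
  have lt : pw H - 2 < u by case: j01 ge => ->; rlra.
  have d0 : dy 0 (pw H - 2) by rewrite dyB //; exact: (@dy_nat 0 2).
  by have := dy_gap d0 du lt; rewrite pm0; rlra.
have hi : u <= pw H - 1.
  have := box_3 b1'; rewrite /= ?pm1 ?pm1' => h3.
  have lt : u < pw H by case: j01 h3 => ->; rlra.
  by have := dy_gap du dH lt; rewrite pm0; rlra.
exfalso; apply: nc; apply: (@box_in_ball 0 H); last by rewrite /=; ilia.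
by box_tac; [exact: du|rewrite ?pw0 ?pm0; rlra..].
Qed.

Lemma conn_frame r x u (k : int) m h (n : nat) : box m h (u - x, k) -> k <= 0 -> n%:Z = 2 * m + 2 * h + k ->
  in_ball r (u, k) ->
  (forall v (l : int), l < 0 -> box m h (v, l) -> in_ball r (x + v, l)) ->
  (forall v (l : int), 0 <= l -> box 0 h (v, l) -> in_ball r (x + v, l)) ->
  conn r (u, k) (x, 0) n.
Proof.
move=> b k0 en oku H1 H2.
have [|[v l] bv l0|[v l] bv l0|n' en' w] := @box_walk_neg (fun q => in_ball r (tr (x, 0) q)) m h _ b k0.
- by rewrite -tr_ivE.
- by rewrite tr_0; apply: H1.
- by rewrite tr_0; apply: H2.
rewrite (_ : n = n'); last by move: en'; rewrite /=; ilia.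
by apply: walk_conn; apply: walk_frame; rewrite tr_iv0.
Qed.

Lemma ex_floor_shift (u y : rat) : exists e, [/\ dy 0 (u - e), y - 1 < e & e <= y].
Proof.
exists (u - (Num.ceil (u - y))%:~R).
have /andP[h1 h2] := real_ceil_itv (num_real (u - y)).
rewrite subKr; split; [exact: dy_int| |]; move: h1 h2; rewrite intrD; rlra.
Qed.

(* The midpoint [(u, 0)] of [(v, 1)] and [(w, -1)] is outside of the ball, and so are all
   the points of height [0] and depth [m] which are not to the left of [2 ^ (h - 1) - 2 ^ - m].
   The path crosses height [0] at [(e, 0)] with [e] just below this bound, goes
   around the bottom at height [- m] to [x = 2 ^ (h - 1)], and from there reaches
   [(w, -1)] passing at height [h - 1] only, which gains 2. *)
Lemma level_mixed_core r (u v w : rat) (m h : int) : (9 <= r)%N ->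
  box m h (v, 1) -> box m h (w, -1) -> 2 * m + 2 * h = r%:Z + 1 -> 1 <= m ->
  0 <= u -> u <= v <= u + 1 -> u - 1 / 2 <= w <= u -> dy 0 (v - u) -> ~~ dy 0 u ->
  ~ in_ball r (u, 0) -> conn r (v, 1) (w, -1) (2 * r - 2).
Proof.
move=> r9 bv bw c m1 u0 /andP[uv vu] /andP[uw wu] dvu ndu nc.
have p1 : pw 1 = 2 by [].
have pm1 : pw (-1) = 1 / 2 by [].
have pm0 : pw (- 0) = 1 by [].
have h1 : 1 <= h by have := box_hi bv; rewrite /=; ilia.
have dv : dy m v by exact: box_dy bv.
have du : dy m u by rewrite -[u](subKr v) dyB // (@dyW 0) //; ilia.
have vhi : v <= pw h - pw (- m) by exact: box_1 bv.
have whi : w <= pw (-1) - 1 + (pw h - pw (- m)) by exact: box_3 bw.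
rewrite pm1 in whi.
have eh : pw h = 2 * pw (h - 1) by rewrite -pwS; congr pw; ring.
have g1 : 1 <= pw (h - 1) by apply: pw_ge1; ilia.
have Q1 : pw (- m) <= 1 / 2 by rewrite -pm1; apply: ler_pw; ilia.
have Q0 := pw_gt0 (- m).
have dh1 : dy 0 (pw (h - 1)) by rewrite dy_pw //; ilia.
have W0 (x : rat) : dy 0 x -> dy m x by apply: dyW; ilia.
have lo : pw (h - 1) - pw (- m) < u.
  rewrite ltNge; apply/negP => le; apply: nc.
  apply: (@box_in_ball m (h - 1)); last by rewrite /=; ilia.
  by box_tac; [exact: du|rewrite ?pw0; rlra..].
(* [e] must be congruent to [u] modulo 1, since a descent from height [h] to 0 changes the
   coordinate by an integer. *)
have [e [de elo ehi]] := ex_floor_shift u (pw (h - 1) - pw (- m)).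
have dme : dy m e by rewrite -[e](subKr u) dyB // W0.
have d1 : dy 0 1 by exact: dy1.
(* Two gaps are gained: one from the strict inequality [elo], one because [e], like [u], is not an
   integer. The result is exactly the condition for joining [e] to [2 ^ (h - 1)] at depth [m]
   without rising above height 0. *)
have e0 : pw (h - 1) - 1 + pw (- m) <= e.
  have dR : dy m (pw (h - 1) - pw (- m) - 1) by rewrite !dyB ?dy_pw ?W0 //; ilia.
  have := dy_gap dR dme => /(_ _) ge.
  have dS : dy m (pw (h - 1) - 1) by rewrite !dyB ?W0.
  apply: (dy_gap dS dme); rewrite lt_neqAle; apply/andP; split; last by have := ge ltac:(rlra); rlra.
  apply/negP => /eqP E; case/negP: ndu.
  have -> : u = u - e + (pw (h - 1) - 1) by rewrite E subrK.
  by rewrite dyD // dyB.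
have okbox (x : rat) (j : int) : dy m x -> - m <= j <= h -> j != 0 ->
    - (pw h - pw (- m)) <= x <= pw h - pw (- m) ->
    pw j - 1 - (pw h - pw (- m)) <= x <= pw j - 1 + (pw h - pw (- m)) -> in_ball r (x, j).
  move=> dx /andP[j1 j2] j0 /andP[x1 x2] /andP[x3 x4].
  by apply: (@box_in_ball m h); [box_tac; [exact: dx|rlra..]|rewrite /=; ilia].
have okv (j : int) : 1 <= j <= h -> in_ball r (v, j).
  move=> /andP[j1 j2]; have J1 := ler_pw j2; have J0 : 1 <= pw j by apply: pw_ge1; ilia.
  by apply: okbox; [exact: dv|ilia|ilia|rlra|rlra].
have oke : in_ball r (e, 0).
  apply: (@box_in_ball m (h - 1)); last by rewrite /=; ilia.
  by box_tac; [exact: dme|rewrite ?pw0; rlra..].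
have okw : in_ball r (w, -1) by apply: (@box_in_ball m h) => //; rewrite /=; ilia.
have okx : in_ball r (pw (h - 1), 0).
  apply: (@box_in_ball 0 h); last by rewrite /=; ilia.
  by box_tac; [exact: dh1|rewrite ?pw0 ?pm0; rlra..].
have [nh enh] : exists n : nat, n%:Z = h by exists (absz h); ilia.
have [nm enm] : exists n : nat, n%:Z = m by exists (absz m); ilia.
have c1 : conn r (v, 1) (v, h) nh.-1.
  by apply: conn_vertical; [ilia|exact: okv].
have dve : dy 0 (v - e) by rewrite -(subrK u v) -addrA dyD.
have c2 : conn r (v, h) (e, 0) nh.
  apply: conn_down; [exact: enh| |by apply: okv; ilia|exact: oke|].
    have lt : v - e < pw (h - 1) + 1 by rlra.
    have := dy_gap dve (dyD dh1 d1) lt; rewrite pm0 => le.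
    by box_tac; [exact: dve|rewrite ?pm0; rlra..].
  move=> x j /andP[j0 jh] dx /andP[x0 x1].
  have J1 := ltr_pw jh; have J0 : 1 <= pw j by apply: pw_ge1; ilia.
  by apply: okbox; [exact: dyD (W0 _ dx)|ilia|ilia|rlra|rlra].
have c3 : conn r (e, 0) (pw (h - 1), 0) (nm + nm).
  apply: (@conn_frame _ _ _ _ m 0); [|by []|ilia|exact: oke| |].
  - by box_tac; [rewrite dyB // W0|rewrite ?pw0; rlra..].
  - move=> x l l0 [/= _ _ lo' hi' dx b1 b2 b3 b4].
    have L0 := pw_gt0 l; have L1 : 2 * pw l <= 1 by apply: (@ltr_pw l 0).
    rewrite pw0 in b1 b2 b3 b4.
    by apply: okbox; [rewrite dyD // W0|ilia|ilia|rlra|rlra].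
  - move=> x l l0 b; have el : l = 0 by have := box_hi b; rewrite /=; ilia.
    by subst l; rewrite (box00 b) addr0.
have c4 : conn r (w, -1) (pw (h - 1), 0) (nm + nm + nh + nh - 3).
  apply: (@conn_frame _ _ _ _ m (h - 1)); [|by []|ilia|exact: okw| |].
  - have [hbig|hsmall] := lerP 2 h.
      have : 2 <= pw (h - 1) by apply: pw_lt1; ilia.
      by move=> g2; box_tac; [apply: dyB; [exact: box_dy bw|exact: W0]|rewrite ?pm1; rlra..].
    have : pw (- m) <= 1 / 4 by rewrite (_ : 1 / 4 = pw (-2)) //; apply: ler_pw; ilia.
    by move=> Q2; box_tac; [apply: dyB; [exact: box_dy bw|exact: W0]|rewrite ?pm1; rlra..].
  - move=> x l l0 [/= _ _ lo' hi' dx b1 b2 b3 b4].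
    have L0 := pw_gt0 l; have L1 : 2 * pw l <= 1 by apply: (@ltr_pw l 0).
    by apply: okbox; [rewrite dyD // W0|ilia|ilia|rlra|rlra].
  - move=> x l l0 [/= _ _ lo' hi' dx b1 b2 b3 b4].
    have L1 : 1 <= pw l by apply: pw_ge1.
    have L2 := ler_pw hi'.
    rewrite pm0 in b1 b2 b3 b4.
    apply: (@box_in_ball 0 h); last by rewrite /=; ilia.
    by box_tac; [rewrite dyD|rewrite ?pm0; rlra..].
(* The length is [(h - 1) + h + 2 * m + (2 * m + 2 * h - 3) = 4 * (m + h) - 4 = 2 * r - 2]. *)
have := conn_trans (conn_trans c1 c2) (conn_trans c3 (conn_sym c4)).
by apply: connW; ilia.
Qed.

(** The point of larger depth is normalised to the smaller depth, which then contains both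
    coordinates, so that the two points lie in boxes with the same [m] and [h]. *)
Lemma level_mixed_frac r (u : rat) (i j : nat) : (9 <= r)%N -> (i <= 1)%N -> (j <= 1)%N ->
  0 <= u -> ~~ dy 0 u -> ~ in_ball r (u, 0) ->
  detour r (u + i%:R, 1) (u - j%:R * (1 / 2), -1).
Proof.
move=> r9 i1 j1 u0 ndu nc sa sb.
have r0 : (0 < r)%N by ilia.
have i01 := bit01 i1; have j01 := bit01 j1.
have di m : 0 <= m -> dy m i%:R by apply: dy_nat.
have dj m : 1 <= m -> dy m (j%:R * (1 / 2)).
  move=> m1; case: j01 => ->; rewrite ?mul0r ?mul1r; first by apply: (@dy_nat m 0); ilia.
  by rewrite -dyN dy_half.
have [m [h [b c]]] := on_sphere_box r0 sa; have [m' [h' [b' c']]] := on_sphere_box r0 sb.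
have d : dy m (u + i%:R) by exact: box_dy b.
have d' : dy m' (u - j%:R * (1 / 2)) by exact: box_dy b'.
have m1' : 1 <= m' by have := box_lo b'; rewrite /=; ilia.
have m0 := box_m b.
have m1 : 1 <= m.
  case: (lerP 1 m) => // m10; case/negP: ndu; have em : m = 0 by ilia.
  by rewrite em in d; rewrite -[u](addrK i%:R) dyB // di.
have dvu : dy 0 (u + i%:R - u) by rewrite addrC addKr di.
have core m2 h2 : box m2 h2 (u + i%:R, 1) -> box m2 h2 (u - j%:R * (1 / 2), -1) ->
    2 * m2 + 2 * h2 = r%:Z + 1 -> 1 <= m2 ->
    conn r (u + i%:R, 1) (u - j%:R * (1 / 2), -1) (2 * r - 2).
  move=> b2 b3 c2 m21; apply: (level_mixed_core r9 b2 b3 c2 m21 u0 _ _ dvu ndu nc).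
    by case: i01 => ->; rlra.
  by case: j01 => ->; rlra.
have [mm|mm] := lerP m m'.
  have dd : dy m (u - j%:R * (1 / 2)).
    by rewrite -[u](addrK i%:R) !dyB ?dj // di.
  have nb := @box_norm m' m h' (u - j%:R * (1 / 2), -1) _ _ dd b'.
  have {nb} : box m (h' + (m' - m)) (u - j%:R * (1 / 2), -1) by apply: nb; rewrite /=; ilia.
  rewrite (_ : h' + (m' - m) = h); last by move: c c'; rewrite /=; ilia.
  by move=> b2; apply: (core _ _ b b2); move: c; rewrite /=; ilia.
have dd : dy m' (u + i%:R).
  rewrite -[u](subrK (j%:R * (1 / 2))); apply: dyD; last by apply: di; ilia.
  exact: dyD d' (dj _ m1').
have nb := @box_norm m m' h (u + i%:R, 1) _ _ dd b.
have {nb} : box m' (h + (m - m')) (u + i%:R, 1) by apply: nb; rewrite /=; ilia.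
rewrite (_ : h + (m - m') = h'); last by move: c c'; rewrite /=; ilia.
by move=> b2; apply: (core _ _ b2 b'); move: c'; rewrite /=; ilia.
Qed.

Lemma level r (u : rat) a b : (9 <= r)%N -> 0 <= u -> ~ in_ball r (u, 0) ->
  adj 1 (u, 0) a -> adj 1 (u, 0) b -> detour r a b.
Proof.
move=> r9 u0 nc; apply: detour_pairs; rewrite ?add0r ?sub0r ?pw0.
- have [du|ndu] := boolP (dy 0 u); first exact: level_up_int.
  apply: detour_D0; [ilia|by []|by []|exact: ndu| |rlra|rlra].
  by rewrite dy_shift // dy1.
- exact: level_down.
move=> i j i1 j1; rewrite mulr1.
have [du|ndu] := boolP (dy 0 u); first exact: level_mixed_int.
exact: level_mixed_frac.
Qed.

(** * Midpoint below height 0 *)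

Lemma highU1 (r : nat) m h v l : (9 <= r)%N -> box m h (v, l) ->
  2 * m + 2 * h = r%:Z + `|l| -> l <= 0 -> 1 <= h -> - (1 / 2) <= v ->
  in_ball r.-1 ((v - 1%:R) / 2, l - 1).
Proof.
move=> r9 b c l0 h1 hv; have r0 : (0 < r)%N by ilia.
apply: (stepU1_ok r0 b c l0); first by ilia.
have m0 := box_m b; have := box_lo b; rewrite /= => lo.
have H2 := pw_lt1 h1.
(* What is needed is [2 ^ h - 2 ^ - m >= 3 / 2], which fails only for [m = 0] and [h = 1]. But
   [m = 0] forces [l = 0], and then [2 * h = r] is large. *)
have [m1|m1] := lerP 1 m.
  have : pw (- m) <= 1 / 2 by rewrite (_ : 1 / 2 = pw (-1)) //; apply: ler_pw; ilia.
  rlra.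
have : 4 <= pw h by rewrite (_ : 4 = pw 2) //; apply: ler_pw; ilia.
have : pw (- m) <= 1 by apply: pw_le1; ilia.
rlra.
Qed.

Lemma conn_high r m h v l m' h' w l' : (9 <= r)%N ->
  in_ball r (v, l) -> box m h (v, l) -> 2 * m + 2 * h = r%:Z + `|l| -> l <= 0 -> 1 <= h ->
  - (1 / 2) <= v ->
  in_ball r (w, l') -> box m' h' (w, l') -> 2 * m' + 2 * h' = r%:Z + `|l'| -> l' <= 0 -> 1 <= h' ->
  - (1 / 2) <= w -> conn r (v, l) (w, l') (2 * r - 2).
Proof.
move=> r9 oka b c l0 h1 hv okb b' c' l0' h1' hw.
apply: (@commonU 1); [by []|ilia|exact: oka|exact: okb| |].
  exact: highU1 b c l0 h1 hv.
exact: highU1 b' c' l0' h1' hw.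
Qed.

Lemma conn_flat r m v l m' w l' : (9 <= r)%N ->
  in_ball r (v, l) -> box m 0 (v, l) -> 2 * m = r%:Z + `|l| -> l <= 0 -> - (1 / 2) < v ->
  in_ball r (w, l') -> box m' 0 (w, l') -> 2 * m' = r%:Z + `|l'| -> l' <= 0 -> - (1 / 2) < w ->
  conn r (v, l) (w, l') (2 * r - 2).
Proof.
move=> r9 oka b c l0 hv okb b' c' l0' hw; have r0 : (0 < r)%N by ilia.
apply: (@commonD 0); [by []|exact: r0|exact: oka|exact: okb| |].
  exact: stepD0_flat_ok b c l0 hv.
exact: stepD0_flat_ok b' c' l0' hw.
Qed.

Lemma on_sphere_box_bounds r v l : (0 < r)%N -> on_sphere r (v, l) ->
  exists m h : int, [/\ box m h (v, l), 2 * m + 2 * h = r%:Z + `|l|, 0 <= m, 0 <= h & - m <= l].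
Proof.
move=> r0 /(on_sphere_box r0)[m [h [b c]]]; exists m, h.
by split=> //; case: b.
Qed.

Lemma box_norm2 (m m' h : int) v l : m' <= m -> 0 <= m' -> - m' <= l -> dy m' v ->
  box m h (v, l) -> box m' (h + (m - m')) (v, l).
Proof. by move=> mm m0 lo d; apply: box_norm => //; rewrite m0 mm. Qed.

(** Two points with positive [h] share the step [(1, 1)], two with [h = 0] share the step down. In
    the mixed case normalisation gives both positive height, except for depth [1 - l] against depth
    [- l] and [h = 1]; there the second point also has a geodesic starting downwards. *)
Lemma below_up r v w (l : int) : (9 <= r)%N -> l <= 0 -> - (1 / 2) < v -> - (1 / 2) < w ->
  dy (1 - l) (v - w) -> w <= v + pw (l - 1) -> v <= w + pw (l - 1) -> detour r (v, l) (w, l).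
Proof.
move=> r9; have r0 : (0 < r)%N by ilia.
have main v' w' m h m' : l <= 0 -> - (1 / 2) < v' -> - (1 / 2) < w' ->
    dy (1 - l) (v' - w') -> w' <= v' + pw (l - 1) -> in_ball r (v', l) -> in_ball r (w', l) ->
    box m 0 (v', l) -> box m' h (w', l) ->
    2 * m = r%:Z + `|l| -> 2 * m' + 2 * h = r%:Z + `|l| -> 1 <= h -> - m' <= l ->
    conn r (v', l) (w', l) (2 * r - 2).
  move=> l0 hv hw d wv oka okb b b' c c' h1 lo.
  have hv' := ltW hv; have hw' := ltW hw; have d' := box_dy b'; rewrite /= in d'.
  have [m1|m1] := lerP (1 - l) m'.
    have dv : dy m' v' by rewrite -(subrK w' v'); exact: dyD (dyW m1 d) d'.
    have b2 : box m' (0 + (m - m')) (v', l) by apply: box_norm2 b; ilia || exact: dv.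
    by apply: (conn_high r9 oka b2 _ l0 _ hv' okb b' c' l0 h1 hw'); ilia.
  have em : m' = - l by ilia.
  have dv : dy (1 - l) v'.
    rewrite -(subrK w' v'); apply: dyD d (dyW _ d'); ilia.
  have [m2|m2] := lerP (2 - l) m.
    have b2 : box (1 - l) (0 + (m - (1 - l))) (v', l) by apply: box_norm2 b; ilia || exact: dv.
    by apply: (conn_high r9 oka b2 _ l0 _ hv' okb b' c' l0 h1 hw'); ilia.
  have eh : h = 1 by ilia.
  have emm : m = 1 - l by ilia.
  have l1 : l < 0 by ilia.
  apply: (@commonD 0); [by []|exact: r0|exact: oka|exact: okb| |].
    exact: stepD0_flat_ok b c l0 hv.
  rewrite eh in b' c'; apply: (stepD0_one_ok r0 b' _ l1 hw'); first by ilia.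
  have := box_3 b; rewrite /= emm em opprK opprB pw0 pwB1 => h3.
  have L : pw l <= 1 / 2 by rewrite (_ : 1 / 2 = pw (-1)) //; apply: ler_pw; ilia.
  by move: wv; rewrite pwB1; rlra.
move=> l0 hv hw d wv vw sa sb; have [oka _] := sa; have [okb _] := sb.
have [m [h [b c m0 h0 lo]]] := on_sphere_box_bounds r0 sa.
have [m' [h' [b' c' m0' h0' lo']]] := on_sphere_box_bounds r0 sb.
have [h1|h1] := lerP 1 h; have [h1'|h1'] := lerP 1 h'.
- exact: (conn_high r9 oka b c l0 h1 (ltW hv) okb b' c' l0 h1' (ltW hw)).
- have e : h' = 0 by ilia.
  rewrite e in b' c'; apply: conn_sym.
  by apply: (main _ _ m' h m) => //; [rewrite -dyN opprB|ilia].
- have e : h = 0 by ilia.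
  by rewrite e in b c; apply: (main _ _ m h' m') => //; ilia.
have e : h = 0 by ilia.
have e' : h' = 0 by ilia.
rewrite e in b c; rewrite e' in b' c'.
by apply: (conn_flat r9 oka b _ l0 hv okb b' _ l0 hw); ilia.
Qed.

Lemma tr_ivD2 (x y : rat) (l : int) : tr (iv (y, -2)) (x, l) = (4 * (x - y), l + 2).
Proof.
rewrite /tr /iv /= opprK (_ : pw 2 = 4) //; congr pair; last by rewrite addrC.
by ring.
Qed.

(** The counterpart of [opposite_up]: the geodesics pass through [(- 1 / 4, -2)] and
    [(- 1 / 2, -2)], whose common neighbour is [(- 1 / 4, -1)]. *)
Lemma opposite_down r (l : int) : (9 <= r)%N -> l <= -2 ->
  on_sphere r (pw l - 1 / 2, l) -> on_sphere r (- (1 / 2), l) ->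
  conn r (pw l - 1 / 2, l) (- (1 / 2), l) (2 * r - 2).
Proof.
move=> r9 l2 sa sb; have [oka _] := sa; have [okb _] := sb.
have r0 : (0 < r)%N by ilia.
have [m [h [b c m0 h0 lo]]] := on_sphere_box_bounds r0 sa.
have [n en] : exists n : nat, n%:Z = - l by exists (absz l); ilia.
have rn : (n <= r)%N by ilia.
have r2 : (2 <= r)%N by ilia.
have r3 : (3 <= r)%N by ilia.
have pm1 : pw (-1) = 1 / 2 by [].
have pm2 : pw (-2) = 1 / 4 by [].
have p2 : pw 2 = 4 by [].
have L0 := pw_gt0 l.
have L4 : pw (l + 2) = 4 * pw l by rewrite pwD p2 mulrC.
have L1 : pw (l + 2) <= 1 by apply: pw_le1; ilia.
have okn x : x = pw (l + 2) - 1 \/ x = 0 -> in_ball (n - 2) (x, l + 2).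
  move=> hx; apply: (@box_in_ball (- (l + 2)) 0); last by rewrite /=; ilia.
  box_tac.
  - case: hx => ->; last by apply: (@dy_nat _ 0); ilia.
    by rewrite dyB ?dy1 ?dy_pw ?opprK //; ilia.
  - by rewrite opprK pw0; case: hx => ->; rlra.
  - by rewrite opprK pw0; case: hx => ->; rlra.
  - by rewrite opprK pw0; case: hx => ->; rlra.
  - by rewrite opprK pw0; case: hx => ->; rlra.
have o1 := in_ballD (i := 0) isT; have o1' := in_ballD (i := 1) isT.
rewrite mul0r oppr0 in o1.
have a1 := adjU1 (- (1 / 4)) (-2); have a1' := adjU0 (- (1 / 2)) (-2).
have a2 := adjU0 (- (1 / 4)) (-2); have a2' := adjU1 (- (1 / 2)) (-2).
rewrite pm2 in a1 a2'.
rewrite (_ : - (1 / 4) + 1 / 4 = 0) in a1; last by field.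
rewrite (_ : - (1 / 2) + 1 / 4 = - (1 / 4)) in a2'; last by field.
have o2 := in_ball_adj o1 (adj_sym a1); have o2' := in_ball_adj o1' (adj_sym a1').
have o3 := in_ball_adj o2 a2.
have c1 : conn r (- (1 / 4), -2) (pw l - 1 / 2, l) (n - 2).
  apply: (conn_geo o2); [|by ilia|exact: oka].
  by rewrite tr_ivD2; apply: okn; left; rewrite L4; field.
have c2 : conn r (- (1 / 2), -2) (- (1 / 2), l) (n - 2).
  apply: (conn_geo o2'); [|by ilia|exact: okb].
  by rewrite tr_ivD2; apply: okn; right; field.
have c3 : conn r (- (1 / 4), -2) (- (1 / 2), -2) 2.
  apply: (@conn_trans _ _ (- (1 / 4), -2 + 1) _ 1 1); apply: conn1.
  - exact: in_ballW r2 o2.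
  - exact: in_ballW r3 o3.
  - exact: a2.
  - exact: in_ballW r3 o3.
  - exact: in_ballW r2 o2'.
  - exact: adj_sym a2'.
have := conn_trans (conn_sym c1) (conn_trans c3 c2).
by apply: connW; ilia.
Qed.

Lemma below_down r v (l : int) : (9 <= r)%N -> l <= -2 -> pw l - 1 / 2 <= v ->
  detour r (v, l) (v - pw l, l).
Proof.
move=> r9 l2 hv sa sb; have [oka _] := sa; have [okb _] := sb.
have r0 : (0 < r)%N by ilia.
have l0 : l <= 0 by ilia.
have L0 := pw_gt0 l.
have [m [h [b c m0 h0 lo]]] := on_sphere_box_bounds r0 sa.
have [m' [h' [b' c' m0' h0' lo']]] := on_sphere_box_bounds r0 sb.
have d := box_dy b; have d' := box_dy b'; rewrite /= in d d'.
have hv1 : - (1 / 2) <= v by rlra.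
have hw1 : - (1 / 2) <= v - pw l by rlra.
have dl : dy m (pw l) by rewrite dy_pw.
have dl' : dy m' (pw l) by rewrite dy_pw.
have [h1|h1] := lerP 1 h; have [h1'|h1'] := lerP 1 h'.
- exact: (conn_high r9 oka b c l0 h1 hv1 okb b' c' l0 h1' hw1).
- have b2 : box m (h' + (m' - m)) (v - pw l, l).
    by apply: box_norm2 b'; ilia || exact: dyB.
  by apply: (conn_high r9 oka b c l0 h1 hv1 okb b2 _ l0 _ hw1); ilia.
- have b2 : box m' (h + (m - m')) (v, l).
    by apply: box_norm2 b; ilia || rewrite -(subrK (pw l) v) dyD.
  by apply: (conn_high r9 oka b2 _ l0 _ hv1 okb b' c' l0 h1' hw1); ilia.
have e : h = 0 by ilia.
have e' : h' = 0 by ilia.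
rewrite e in b c; rewrite e' in b' c'.
have [lt|ge] := ltrP (- (1 / 2)) (v - pw l).
  have gt : - (1 / 2) < v by rlra.
  by apply: (conn_flat r9 oka b _ l0 gt okb b' _ l0 lt); ilia.
have ew : v - pw l = - (1 / 2) by rlra.
have ev : v = pw l - 1 / 2 by rlra.
by move: sa sb; rewrite ew ev; apply: opposite_down.
Qed.

(** The lower bound on [w] is where [stepD0_one] stops applying. The paths meet at [(1, 0)], at
    distance 2 from the origin. From there neither has to rise: [w] is reached in [r - 2] steps, and
    [v] in [r] steps by way of [(v - 1 / 2, -1)]. *)
Lemma below_corner r (v w : rat) (m : int) : (9 <= r)%N ->
  in_ball r (v, 0) -> in_ball r (w, -2) -> box m 0 (v, 0) -> box m 1 (w, -2) -> 2 * m = r%:Z ->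
  3 / 4 - pw (- m) < w -> w <= v -> conn r (v, 0) (w, -2) (2 * r - 2).
Proof.
move=> r9 okv okw bv bw c wlo wv.
have pm1 : pw (-1) = 1 / 2 by [].
have pm2 : pw (-2) = 1 / 4 by [].
have p1 : pw 1 = 2 by [].
have m1 : 4 <= m by ilia.
have Q0 := pw_gt0 (- m).
have Q1 : pw (- m) <= 1 / 16 by rewrite (_ : 1 / 16 = pw (-4)) //; apply: ler_pw; ilia.
have vhi := box_1 bv; have whi := box_3 bw.
rewrite /= pw0 in vhi; rewrite /= p1 pm2 in whi.
have dv : dy m v by exact: box_dy bv.
have dw : dy m w by exact: box_dy bw.
have d1 : dy m 1 by apply: dy1; ilia.
have d12 : dy m (1 / 2) by rewrite -dyN dy_half //; ilia.
have o1 : in_ball 1 (1, 1) by exact: (in_ballU (i := 1)).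
have o2 : in_ball 2 (1, 0) by exact: in_ball_adj o1 (adj_sym (adjU0 1 0)).
have a1 : adj 1 (v - 1 / 2, -1) (v, 0).
  by have := adjU1 (v - 1 / 2) (-1); rewrite pm1 subrK.
have okp : in_ball r (v - 1 / 2, -1).
  apply: (@box_in_ball m 0); last by rewrite /=; ilia.
  by box_tac; [exact: dyB|rewrite ?pw0 ?pm1; rlra..].
have c1 : conn r (1, 0) (v - 1 / 2, -1) r.-1.
  apply: (conn_geo o2); [|by ilia|exact: okp].
  rewrite tr_iv0; apply: (@box_in_ball m 0); last by rewrite /=; ilia.
  by box_tac; [apply: dyB => //; exact: dyB|rewrite ?pw0 ?pm1; rlra..].
have c2 : conn r (1, 0) (w, -2) (r - 2).
  apply: (conn_geo o2); [|by ilia|exact: okw].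
  rewrite tr_iv0; apply: (@box_in_ball m 0); last by rewrite /=; ilia.
  by box_tac; [exact: dyB|rewrite ?pw0 ?pm2; rlra..].
have c3 : conn r (v - 1 / 2, -1) (v, 0) 1 by apply: conn1.
have := conn_trans (conn_sym (conn_trans c1 c3)) c2.
by apply: connW; ilia.
Qed.

Lemma below_mixed r (v w : rat) (l : int) : (9 <= r)%N -> l <= 0 -> - (1 / 2) < w ->
  w <= v -> v <= w + 3 / 2 * pw (l - 1) -> dy (2 - l) (v - w) ->
  detour r (v, l) (w, l - 2).
Proof.
move=> r9 l0 hw wv vw d sa sb; have [oka _] := sa; have [okb _] := sb.
have r0 : (0 < r)%N by ilia.
have l2 : l - 2 <= 0 by ilia.
have hv : - (1 / 2) < v by rlra.
have hv' := ltW hv; have hw' := ltW hw.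
have pm1 : pw (-1) = 1 / 2 by [].
have pm2 : pw (-2) = 1 / 4 by [].
have [m [h [b c m0 h0 lo]]] := on_sphere_box_bounds r0 sa.
have [m' [h' [b' c' m0' h0' lo']]] := on_sphere_box_bounds r0 sb.
have dv := box_dy b; have dw := box_dy b'; rewrite /= in dv dw.
have [h1|h1] := lerP 1 h; have [h1'|h1'] := lerP 1 h'.
- exact: (conn_high r9 oka b c l0 h1 hv' okb b' c' l2 h1' hw').
- have e : h' = 0 by ilia.
  rewrite e in b' c'.
  have [m1|m1] := lerP (2 - l) m.
    have dw2 : dy m w by rewrite -[w](subKr v); exact: dyB dv (dyW m1 d).
    have b2 : box m (0 + (m' - m)) (w, l - 2).
      by apply: box_norm2 b'; [ilia|ilia|ilia|exact: dw2].
    by apply: (conn_high r9 oka b c l0 h1 hv' okb b2 _ l2 _ hw'); ilia.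
  have dw2 : dy (2 - l) w.
    rewrite -[w](subKr v); apply: dyB (dyW _ dv) d; ilia.
  have [m2|m2] := lerP (3 - l) m'.
    have b2 : box (2 - l) (0 + (m' - (2 - l))) (w, l - 2).
      by apply: box_norm2 b'; [ilia|ilia|ilia|exact: dw2].
    by apply: (conn_high r9 oka b c l0 h1 hv' okb b2 _ l2 _ hw'); ilia.
  (* The boxes are too shallow for a normalisation to positive height; both geodesics start
     downwards. *)
  have em' : m' = 2 - l by ilia.
  have em : m = - l by ilia.
  have eh : h = 1 by ilia.
  have l1 : l < 0 by ilia.
  rewrite eh in b c.
  apply: (@commonD 0); [by []|exact: r0|exact: oka|exact: okb| |].
    apply: (stepD0_one_ok r0 b _ l1 hv'); first by ilia.
    have := box_3 b'; rewrite /= em' em opprK opprB pw0 => h3.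
    have L : pw (l - 1) <= 1 / 4 by rewrite -pm2; apply: ler_pw; ilia.
    by rlra.
  by apply: (stepD0_flat_ok r0 b' _ l2 hw); ilia.
- have e : h = 0 by ilia.
  rewrite e in b c.
  have dv2 : dy m' v.
    rewrite -(subrK w v); apply: dyD (dyW _ d) dw; ilia.
  have [h2|h2] := lerP 2 h'.
    have b2 : box m' (0 + (m - m')) (v, l).
      by apply: box_norm2 b; [ilia|ilia|ilia|exact: dv2].
    by apply: (conn_high r9 oka b2 _ l0 _ hv' okb b' c' l2 h1' hw'); ilia.
  have eh : h' = 1 by ilia.
  have em : m' = m by ilia.
  rewrite eh em in b' c'.
  have vhi := box_3 b; rewrite /= pw0 in vhi.
  have l2' : l - 2 < 0 by ilia.
  have L0 := pw_gt0 (l - 2).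
  have [le|gt] := lerP w (1 / 2 + pw (l - 2) - pw (- m)).
    apply: (@commonD 0); [by []|exact: r0|exact: oka|exact: okb| |].
      by apply: (stepD0_flat_ok r0 b _ l0 hv); ilia.
    by apply: (stepD0_one_ok r0 b' _ l2' hw' le); ilia.
  (* A box with [h = 0] gives [v <= 2 ^ l - 2 ^ - m], which for [l <= -1] contradicts [w <= v]. Only
     [l = 0] remains. *)
  have [l1|l1] := lerP l (-1).
    have L : pw l <= 1 / 2 by rewrite -pm1; apply: ler_pw; ilia.
    have : w < w by rlra.
    by rewrite ltxx.
  have el : l = 0 by ilia.
  have pl2 : pw (l - 2) = 1 / 4 by rewrite el.
  have gt' : 3 / 4 - pw (- m) < w by rlra.
  by subst l; apply: (below_corner r9 oka okb b b' _ gt' wv); move: c; rewrite /=; ilia.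
have e : h = 0 by ilia.
have e' : h' = 0 by ilia.
rewrite e in b c; rewrite e' in b' c'.
by apply: (conn_flat r9 oka b _ l0 hv okb b' _ l2 hw); ilia.
Qed.

Lemma below r (u : rat) (k : int) a b : (9 <= r)%N -> k <= -1 -> pw k - 1 <= 2 * u ->
  adj 1 (u, k) a -> adj 1 (u, k) b -> detour r a b.
Proof.
move=> r9 k1 z0.
have K0 := pw_gt0 k.
have kk : pw (k - 1) = pw k / 2 by exact: pwB1.
have e11 : k + 1 - 1 = k by ring.
have e2 : k - 1 = k + 1 - 2 by ring.
apply: detour_pairs.
- apply: below_up; rewrite ?e11; [by []|by ilia|by rlra|by rlra| |by rlra|by rlra].
  have -> : u - (u + pw k) = - pw k by ring.
  by rewrite dyN dy_pw //; ilia.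
- by apply: below_down; [by []|by ilia|rlra].
move=> i j i1 j1.
have mixed v w : - (1 / 2) < w -> w <= v -> v <= w + 3 / 2 * pw k ->
    dy (1 - k) (v - w) -> detour r (v, k + 1) (w, k - 1).
  move=> hw wv vw d; rewrite e2; apply: below_mixed => //; [by ilia|by rewrite e11|].
  by rewrite (_ : 2 - (k + 1) = 1 - k) //; ring.
have dk : dy (1 - k) (pw k) by rewrite dy_pw //; ilia.
have dk1 : dy (1 - k) (pw (k - 1)) by rewrite dy_pw //; ilia.
have d0 : dy (1 - k) 0 by apply: (@dy_nat _ 0); ilia.
have di : dy (1 - k) (i%:R * pw k) by case: (bit01 i1) => ->; rewrite ?mul0r ?mul1r.
have dj : dy (1 - k) (j%:R * pw (k - 1)) by case: (bit01 j1) => ->; rewrite ?mul0r ?mul1r.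
have i01 : 0 <= i%:R * pw k <= pw k by case: (bit01 i1) => ->; rlra.
have j01 : 0 <= j%:R * pw (k - 1) <= pw k / 2 by rewrite kk; case: (bit01 j1) => ->; rlra.
move: (i%:R * pw k) (j%:R * pw (k - 1)) di dj i01 j01 => x y dx dy' /andP[x0 x1] /andP[y0 y1].
have [lt|ge] := ltrP (- (1 / 2)) (u - y).
  apply: mixed; [exact: lt|rlra|rlra|].
  by rewrite (_ : u + x - (u - y) = x + y) ?dyD //; ring.
have eu : u = (pw k - 1) / 2 by rlra.
have ey : y = pw k / 2 by rlra.
(* Again the extreme case has its midpoint on the axis of [mirror], and the reflection moves the
   lower neighbour to [u]. *)
apply: detour_mirror; rewrite /mirror /= pwS kk.
apply: mixed; [rlra|rlra|rlra|].
have -> : 2 * pw k - 1 - (u + x) - (pw k / 2 - 1 - (u - y)) = pw k - x.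
  by rewrite eu ey; field.
exact: dyB.
Qed.

Theorem ball_connected r c a b : (9 <= r)%N -> ~ in_ball r c -> adj 1 c a -> adj 1 c b -> detour r a b.
Proof.
move=> r9.
have main u (k : int) a' b' : pw k - 1 <= 2 * u -> ~ in_ball r (u, k) ->
    adj 1 (u, k) a' -> adj 1 (u, k) b' -> detour r a' b'.
  move=> z0 nc ha hb.
  have [k1|k1] := lerP k (-1); first exact: (below r9 k1 z0 ha hb).
  have [e|ne] := eqVneq k 0.
    subst k; apply: (level r9 _ nc ha hb); move: z0; rewrite pw0; rlra.
  have k2 : 1 <= k by ilia.
  have [du|ndu] := boolP (dy 0 u); last exact: (above_frac r9 z0 k2 ndu ha hb).
  have [e|ne1] := eqVneq k 1.
    by subst k; apply: (above_one r9 _ du ha hb); move: z0; rewrite (_ : pw 1 = 2) //; rlra.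
  by apply: (above_int _ _ du ha hb); [ilia|ilia].
case: c => u k nc ha hb.
have [z0|z0] := lerP (pw k - 1) (2 * u); first exact: (main _ _ _ _ z0 nc ha hb).
apply: detour_mirror; apply: (main (pw k - 1 - u) k).
- by rlra.
- by move=> /in_ball_mirror; rewrite -[(_ - _, k)]/(mirror (u, k)) mirrorK.
- exact: (adj_mirror ha).
- exact: (adj_mirror hb).
Qed.

(** * Three generators *)

Lemma adjW (d d' : nat) p q : (d <= d')%N -> adj d p q -> adj d' p q.
Proof.
by move=> dd [] [i i1 e]; [left|right]; exists i => //; apply: leq_trans dd.
Qed.

Lemma walkWd (d d' : nat) S p q n : (d <= d')%N -> walk d S p q n -> walk d' S p q n.
Proof.
move=> dd; elim=> [{}p Sp|{}p s {}q {}n Sp ps _ IH]; first exact: Walk0.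
exact: WalkS (adjW dd ps) IH.
Qed.

(** [H] is not the peak of the given walk but the greatest height that [n] steps between these
    endpoints allow. Climbing to it with the largest generator sums to the geometric series
    [d * (2 ^ H - 2 ^ k)]. *)
Lemma walk_rise d S p q n : walk d S p q n ->
  exists H : int, [/\ 2 * H = n%:Z + p.2 + q.2, p.2 <= H, q.2 <= H &
    q.1 - p.1 <= d%:R * (pw H - pw p.2)].
Proof.
elim=> [{}p _|{}p s {}q {}n _ ps _ [H [e1 e2 e3 e4]]].
  by exists p.2; split=> //; [lia|rewrite !subrr mulr0].
case: ps => -[i id es]; [rewrite es in e1 e2 e4|rewrite es].
  exists H; move: e1 e2 e4; rewrite /= pwS => e1 e2 e4; split=> //; try lia.
  have : i%:R * pw p.2 <= d%:R * pw p.2 by rewrite ler_pM2r ?pw_gt0 // ler_nat.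
  move: e4; rewrite !mulrBr; lra.
exists (H + 1); rewrite /= !pwS; split; try lia.
have : 0 <= i%:R * pw s.2 by rewrite mulr_ge0 ?ler0n // ltW // pw_gt0.
have : d%:R * pw s.2 <= d%:R * pw H by rewrite ler_wpM2l ?ler0n // ler_pw.
move: e4; rewrite !mulrBr; lra.
Qed.

(** A step whose ends have height at least 1 changes the coordinate by a multiple of 2, so an odd
    change can only happen through height 0. *)
Lemma walk_cross d S p q n : walk d S p q n -> 1 <= p.2 ->
  (exists y n1 n2, [/\ n = (n1 + n2)%N, S (y, 0), walk d S p (y, 0) n1 &
     walk d S (y, 0) q n2]) \/
  dy (-1) (q.1 - p.1).
Proof.
elim=> [{}p _ _|{}p s {}q {}n Sp ps w IH p1].
  by right; rewrite subrr /dy mul0r.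
have [e|ne] := eqVneq s.2 0.
  left; exists s.1, 1%N, n; have := walk_fst w; case: s e ps w {IH} => y l /= -> ps w Ss.
  by split=> //; apply: walk1.
have [s1 ds] : 1 <= s.2 /\ dy (-1) (s.1 - p.1).
  have dn (i : nat) (k : int) : 1 <= k -> dy (-1) (i%:R * pw k).
    move=> k1; have dk : dy (-1) (pw k) by rewrite dy_pw //; lia.
    by move: dk; rewrite /dy -mulrA => dk; rewrite rpredM // intr_nat.
  case: ps => -[i id es]; rewrite es /=.
    by split; [lia|rewrite addrC addKr dn].
  move: p1 ne; rewrite es /= => p1 ne; split; first by lia.
  by rewrite opprD addrA subrr sub0r dyN dn //; lia.
have [[y [n1 [n2 [-> Sy w1 w2]]]]|dq] := IH s1.
  by left; exists y, n1.+1, n2; split=> //; apply: WalkS ps w1.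
by right; rewrite -(subrK s.1 q.1) -addrA dyD.
Qed.

Lemma walk_up2 x (k : int) n : walk 2 anywhere (2 * pw k + x, k) (2 * pw (k + n%:Z) + x, k + n%:Z) n.
Proof.
elim: n k => [|n IH] k; first by rewrite addr0; apply: Walk0.
have := IH (k + 1); rewrite (_ : k + 1 + n%:Z = k + n.+1%:Z); last by lia.
apply: WalkS => //; left; exists 2%N => //.
by rewrite upvP pwS; congr pair; ring.
Qed.

Lemma walk_peak x (k : int) (h : nat) : k <= h%:Z -> 1 <= h%:Z ->
  exists2 n : nat, n%:Z = 2 * h%:Z - k - 1 &
    walk 2 anywhere (2 * pw k + x, k) (2 * pw h + x, 1) n.
Proof.
move=> kh h1.
have [n en] : exists n : nat, n%:Z = h%:Z - k by exists (absz (h%:Z - k)); lia.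
exists (n + h.-1)%N; first by lia.
have := walk_up2 x k n; rewrite (_ : k + n%:Z = h%:Z); last by lia.
move=> w; apply: walk_cat w _; apply: walk_rev.
have := @vertical anywhere (2 * pw h + x) 1 h.-1 (fun _ _ => I).
rewrite (_ : 1 + h.-1%:Z = h%:Z); last by lia.
exact: walkWd.
Qed.

Definition ball2 (r : nat) (g : vert) : Prop :=
  exists2 n, (n <= r)%N & walk 2 anywhere (0, 0) g n.

Lemma walk_far h S y (u : rat) n : (0 < h)%N -> walk 2 S (y, 0) (u, 1) n ->
  y + pw h - 2 < u -> (2 * h - 1 <= n)%N.
Proof.
move=> h0 /walk_rise[H [/= e1 _ H1]]; rewrite pw0 => e2 lt.
rewrite leqNgt; apply/negP => nh.
have HH : 2 * pw H <= pw h by apply: ltr_pw; lia.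
have : u < u by lra.
by rewrite ltxx.
Qed.

Lemma ball2_level (h : nat) y : ball2 (2 * h - 1) (y, 0) -> (0 < h)%N -> y <= pw h - 2.
Proof.
move=> [n nh /walk_rise[H [/= e1 _ H1]]]; rewrite pw0 => e2 h0.
have HH : 2 * pw H <= pw h by apply: ltr_pw; lia.
lra.
Qed.

(** The coordinates differ by 1, so the walk visits height 0 at some [y <= 2 ^ h - 2]. Both ends are
    then more than [2 ^ h - 2] to the right of [y], so each half is at least as long as the
    radius. *)
Lemma detour2 (h : nat) n : (0 < h)%N ->
  walk 2 (ball2 (2 * h - 1)) (2 * pw h - 2, 1) (2 * pw h - 3, 1) n ->
  (2 * (2 * h - 1) <= n)%N.
Proof.
move=> h0 /walk_cross /(_ isT)[[y [n1 [n2 [-> Sy w1 w2]]]]|/= d]; last first.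
  have := @dy_ge (-1) 1 _ ltr01; rewrite -dyN.
  rewrite (_ : - 1 = 2 * pw h - 3 - (2 * pw h - 2)); last by ring.
  by move=> /(_ d).
have hy := ball2_level Sy h0.
have := walk_far h0 (walk_rev w1); have := walk_far h0 w2.
move=> /(_ ltac:(lra)) ? /(_ ltac:(lra)) ?; lia.
Qed.

(** * The Baumslag-Solitar group *)

Local Open Scope classical_set_scope.

Definition dyadic (x : rat) : bool := `[< exists m : int, dy m x >].

Lemma dyadic_tr p q : dyadic p.1 -> dyadic q.1 -> dyadic (tr p q).1.
Proof.
move=> /asboolP[m dp] /asboolP[n dq]; apply/asboolP; rewrite /tr /=.
exists (Num.max m (n - p.2)); apply: dyD.
  by apply: dyW dp; rewrite le_max lexx.
apply: (@dyW (n - p.2)); first by rewrite le_max lexx orbT.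
by rewrite /dy mulrAC -pwD addrC subrK mulrC.
Qed.

Lemma dyadic_iv p : dyadic p.1 -> dyadic (iv p).1.
Proof.
move=> /asboolP[m dp]; apply/asboolP; exists (m + p.2); rewrite /iv /= dyN.
by rewrite /dy mulrAC -pwD addrC addrK mulrC.
Qed.

(* The Baumslag-Solitar group BS(1,2), i.e. Z[1/2] extended by the
   automorphism [u |-> 2 * u]. *)
Record bs := Bs { bsval :> vert; bsP : dyadic bsval.1 }.
HB.instance Definition _ := [isSub for bsval].
HB.instance Definition _ := [Choice of bs by <:].

Lemma bs1P : dyadic ((0, 0) : vert).1.
Proof. by apply/asboolP; exists 0; rewrite /dy mul0r. Qed.

Definition bs_one := Bs bs1P.
Definition bs_mul (p q : bs) := Bs (dyadic_tr (bsP p) (bsP q)).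
Definition bs_inv (p : bs) := Bs (dyadic_iv (bsP p)).

Lemma bs_mulA : associative bs_mul.
Proof. by move=> p q r; apply: val_inj; apply: trA. Qed.

Lemma bs_mul1 : left_id bs_one bs_mul.
Proof. by move=> p; apply: val_inj; apply: tr1. Qed.

Lemma bs_mulr1 : right_id bs_one bs_mul.
Proof. by move=> p; apply: val_inj; apply: trg1. Qed.

Lemma bs_mulV : left_inverse bs_one bs_inv bs_mul.
Proof. by move=> p; apply: val_inj; apply: Vtr. Qed.

Lemma bs_mulVr : right_inverse bs_one bs_inv bs_mul.
Proof. by move=> p; apply: val_inj; apply: trV. Qed.

HB.instance Definition _ :=
  isGroup.Build bs bs_mulA bs_mul1 bs_mulr1 bs_mulV bs_mulVr.

Lemma gen_dyadic (i : nat) : dyadic ((i%:R, 1) : vert).1.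
Proof. by apply/asboolP; exists 0; exact: dy_nat. Qed.

Definition gen (i : nat) : bs := Bs (gen_dyadic i).

Definition gens (d : nat) : set bs := [set gen i | i in [set i | (i <= d)%N]].

Lemma val_mul_gen (p : bs) i : bsval (p * gen i)%g = upv i (bsval p).
Proof. by rewrite /= /tr /upv /=; congr pair; rewrite mulrC. Qed.

(** * Walks and edge paths in the Cayley graphs *)

Lemma upv_inj i : injective (upv i).
Proof.
move=> [u k] [v l]; rewrite !upvP => -[e1 /addIr e2].
by rewrite e2 in e1 *; rewrite (addIr _ e1).
Qed.

Lemma edge_walk d (E : set (bs * bs)) (S : vert -> Prop) u v n :
  (forall g a, gens d a -> E (g, a) -> S (bsval g) /\ S (bsval (g * a)%g)) ->
  S (bsval u) -> edge_path (gens d) E u v n -> walk d S (bsval u) (bsval v) n.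
Proof.
move=> ES Su w; elim: w Su => [{}u Su|{}u a {}v {}n ga ea _ IH Su|{}u a {}v {}n ga ea _ IH Su].
- exact: Walk0.
- apply: WalkS (IH _) => //; last by case: (ES _ _ ga ea).
  by case: ga => i id <-; left; exists i => //; rewrite val_mul_gen.
apply: WalkS (IH _) => //; last by case: (ES _ _ ga ea).
by case: ga => i id <-; right; exists i => //; rewrite val_mul_gen.
Qed.

Lemma walk_edge d (E : set (bs * bs)) (S : vert -> Prop) u v n :
  (forall g a, gens d a -> S (bsval g) -> S (bsval (g * a)%g) -> E (g, a)) ->
  walk d S (bsval u) (bsval v) n -> edge_path (gens d) E u v n.
Proof.
move=> SE; move ep: (bsval u) => p; move eq: (bsval v) => q w.
elim: w u v ep eq => [{}p _ u v ep eq|{}p s {}q {}n Sp ps w IH u v ep eq].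
  by have -> : u = v; [apply: val_inj; rewrite /= ep eq|exact: EdgePath0].
have Ss := walk_fst w.
case: ps => -[i id es].
  have gi : gens d (gen i) by exists i.
  have es' : bsval (u * gen i)%g = s by rewrite val_mul_gen ep es.
  by apply: (EdgePathFwd gi); [apply: SE; rewrite ?ep ?es'|apply: IH].
have gi : gens d (gen i) by exists i.
have eu : u = (u * (gen i)^-1 * gen i)%g by rewrite -mulgA mulVg mulg1.
have es' : bsval (u * (gen i)^-1)%g = s.
  by apply: (@upv_inj i); rewrite -val_mul_gen -eu ep es.
rewrite eu; apply: (EdgePathBwd gi); last by apply: IH.
by apply: SE => //; rewrite ?es' // -eu ep.
Qed.

Lemma edge_path_walk d u v n :
  edge_path (gens d) setT u v n <-> walk d anywhere (bsval u) (bsval v) n.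
Proof. by split=> [|/walk_edge]; [apply: edge_walk|apply]. Qed.

Lemma dyadic_in_ball p : dyadic p.1 -> exists n, in_ball n p.
Proof.
case: p => u k /asboolP[m0 /= d].
have [m [mm m1 mk]] : exists m : int, [/\ m0 <= m, 1 <= m & - m <= k].
  by exists (`|m0| + `|k| + 1); split; lia.
have {mm} d := dyW mm d.
have [h [h1 hu hk]] : exists h : int, [/\ k <= h, 0 <= h & `|u| + pw k + 2 <= pw h].
  pose N := Num.truncn (`|u| + pw k + 2).
  have hN : `|u| + pw k + 2 < N.+1%:R.
    by have := @truncn_itv rat (`|u| + pw k + 2) _; rewrite -/N; case/(_ _)/andP => //;
      rewrite addr_ge0 // addr_ge0 // ltW // pw_gt0.
  exists (`|k| + N.+1%:Z); split; [lia|lia|].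
  apply: le_trans (ltW hN) _; apply: le_trans (ler_pw (_ : N.+1%:Z <= _)); last by lia.
  by rewrite /pw -exprnP -natrX ler_nat ltnW // ltn_expl.
exists (absz (2 * m + 2 * h)); exists m, h; split; last by rewrite /=; lia.
have Q1 : pw (- m) <= 1 by apply: pw_le1; lia.
have K0 := pw_gt0 k.
have u1 : u <= `|u| by exact: ler_norm.
have u2 : - u <= `|u| by rewrite -normrN ler_norm.
by box_tac => //; lra.
Qed.

Lemma gens_walk (d : nat) (u v : bs) : (0 < d)%N ->
  exists n, walk d anywhere (bsval u) (bsval v) n.
Proof.
move=> d0; have [n /in_ball_ex_walk[n' _ w]] := dyadic_in_ball (bsP (u^-1 * v)%g).
exists n'; have := @walk_tr 1 _ anywhere (bsval u) _ _ _ (fun _ _ => I) w.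
by rewrite /= trA trV tr1 trg1; apply: walkWd.
Qed.

(** The infimum is attained, being taken over a set of natural numbers that is nonempty because
    [gens d] generates the group. *)
Lemma distE (R : realType) (d : nat) (d0 : (0 < d)%N) (u v : bs) : exists n, [/\ dist R (gens d) u v = n%:R,
  walk d anywhere (bsval u) (bsval v) n &
  forall n', walk d anywhere (bsval u) (bsval v) n' -> (n <= n')%N].
Proof.
have [n0 w0] := gens_walk u v d0.
pose P n := `[< walk d anywhere (bsval u) (bsval v) n >].
have exP : exists n, P n by exists n0; apply/asboolP.
case: (ex_minnP exP) => n /asboolP w mn; exists n.
have min n' : walk d anywhere (bsval u) (bsval v) n' -> (n <= n')%N.
  by move=> w'; apply: mn; apply/asboolP.
split=> //; rewrite /dist; set X := (X in inf X).
have Xn : X n%:R by exists n => //=; apply/edge_path_walk.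
have lX : lbound X n%:R by move=> _ [n' /edge_path_walk/min nn <-]; rewrite ler_nat.
by apply/eqP; rewrite eq_le ge_inf ?lb_le_inf //; exists n%:R.
Qed.

Lemma dist_le (R : realType) (d : nat) (d0 : (0 < d)%N) (u v : bs) n : dist R (gens d) u v <= n%:R <->
  exists2 n', (n' <= n)%N & walk d anywhere (bsval u) (bsval v) n'.
Proof.
have [m [-> w mn]] := distE R d0 u v; split=> [|[n' nn /mn mm]]; rewrite ler_nat.
  by exists m.
exact: leq_trans nn.
Qed.

Lemma dist_in_ball (R : realType) (g : bs) n : dist R (gens 1) 1%g g <= n%:R <-> in_ball n (bsval g).
Proof.
split=> [/(dist_le R (isT : (0 < 1)%N))[n' nn w]|/in_ball_ex_walk w].
  by apply: in_ballW nn _; have := in_ball_walk in_ball0 w; rewrite add0n.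
exact/(dist_le R (isT : (0 < 1)%N)).
Qed.

Lemma sphere_on_sphere (R : realType) r (g : bs) : (0 < r)%N -> sphere R (gens 1) r g ->
  on_sphere r (bsval g).
Proof.
rewrite /sphere /= => r0 e; split; first by apply/(dist_in_ball R); rewrite e.
by move/(dist_in_ball R); rewrite e ler_nat; lia.
Qed.

Lemma on_sphere_parity r p : (0 < r)%N -> on_sphere r p -> exists n : int, r%:Z + p.2 = 2 * n.
Proof.
move=> r0 /(on_sphere_box r0)[m [h [_ c]]].
case: (lerP 0 p.2) => p0; [exists (m + h) | exists (m + h + p.2)]; lia.
Qed.

Lemma on_sphere_adj r p q : (0 < r)%N -> on_sphere r p -> on_sphere r q -> ~ adj 1 p q.
Proof.
move=> r0 /(on_sphere_parity r0)[n en] /(on_sphere_parity r0)[n' en'].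
by case=> -[i _ e]; move: en en'; rewrite e /=; lia.
Qed.

(** By parity the ends of an edge are not both on the sphere, so every point of the edge is within
    [r] of the origin by way of an end inside it. *)
Lemma ball_edge (R : realType) r g a : (0 < r)%N -> gens 1 a ->
  in_ball r (bsval g) -> in_ball r (bsval (g * a)%g) -> edge_in_ball R (gens 1) r (g, a).
Proof.
move=> r0 ga og oga t /= /andP[t0 t1]; rewrite /dist_point /=.
have [s [e1 w1 m1]] := distE R (isT : (0 < 1)%N) 1%g g.
have [s' [e2 w2 m2]] := distE R (isT : (0 < 1)%N) 1%g (g * a)%g.
have sr : (s <= r)%N by move/(dist_in_ball R): og; rewrite e1 ler_nat.
have sr' : (s' <= r)%N by move/(dist_in_ball R): oga; rewrite e2 ler_nat.
have ne : ~ (s = r /\ s' = r).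
  move=> [es es']; apply: (@on_sphere_adj r (bsval g) (bsval (g * a)%g)) => //.
  - by apply: (@sphere_on_sphere R) => //; rewrite /sphere /= e1 es.
  - by apply: (@sphere_on_sphere R) => //; rewrite /sphere /= e2 es'.
  - by case: ga => i id <-; left; exists i => //; rewrite val_mul_gen.
rewrite e1 e2 ge_min; apply/orP.
have [lt|ge] := ltnP s r; [left|right].
  have : (s.+1%:R <= r%:R :> R) by rewrite ler_nat.
  by rewrite -natr1; lra.
have lt' : (s' < r)%N by rewrite ltn_neqAle sr' andbT; apply/eqP => es'; apply: ne; split=> //; lia.
have : (s'.+1%:R <= r%:R :> R) by rewrite ler_nat.
by rewrite -natr1; lra.
Qed.

Lemma walk_ball_edge (R : realType) r (u v : bs) n : (0 < r)%N ->
  walk 1 (in_ball r) (bsval u) (bsval v) n ->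
  edge_path (gens 1) (edge_in_ball R (gens 1) r) u v n.
Proof. by move=> r0; apply: walk_edge => g a ga og oga; apply: ball_edge. Qed.

Lemma gens1_MpAC (R : realType) : MpAC R (gens 1).
Proof.
exists 9%N => r r9 a b sa sb /(@dist_le R 1 isT a b 2)[n n2 w].
have r0 : (0 < r)%N by lia.
have {}sa := sphere_on_sphere r0 sa; have {}sb := sphere_on_sphere r0 sb.
suff [n' nn w'] : conn r (bsval a) (bsval b) (2 * r - 2).
  exists n'; split; first exact: walk_ball_edge.
  have : (n' + 2)%:R <= (2 * r)%:R :> R by rewrite ler_nat; lia.
  by rewrite natrD natrM; lra.
have [oka _] := sa; have [okb _] := sb.
case: w sa sb oka okb n2 => [p _|p q s m _ pq w] sa sb oka okb n2.
  by exists 0 => //; apply: Walk0.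
case: w pq sb okb n2 => [{}q _|{}q s' t m' _ qs w] pq sb okb n2.
  by case: (on_sphere_adj r0 sa sb pq).
case: w qs sb okb n2 => [{}s' _|] qs sb okb n2; last by lia.
(* Length 1 was excluded by parity. If the midpoint of a walk of length 2 is in the ball, this walk
   itself will do. *)
case: (pselect (in_ball r q)) => okq.
  by exists 2%N; [lia|apply: WalkS pq (walk1 _ _ _)].
exact: (ball_connected r9 okq (adj_sym pq) qs).
Qed.

Lemma MpAC_MAC (R : realType) (G : groupType) (A : set G) : MpAC R A -> MAC R A.
Proof.
move=> [r0 H]; exists r0 => r rr a b sa sb ab.
by have [n [w h]] := H r rr a b sa sb ab; exists n; split=> //; lra.
Qed.

Lemma edge_in_ball2 (R : realType) r g a : gens 2 a ->
  edge_in_ball R (gens 2) r (g, a) -> ball2 r (bsval g) /\ ball2 r (bsval (g * a)%g).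
Proof.
move=> ga E; have two : (0 < 2)%N by [].
have ad : adj 2 (bsval g) (bsval (g * a)%g).
  by case: ga => i id <-; left; exists i => //; rewrite val_mul_gen.
have D (u : bs) n : dist R (gens 2) 1%g u <= n%:R <-> ball2 n (bsval u) by exact: dist_le.
have step (u v : bs) : adj 2 (bsval v) (bsval u) -> dist R (gens 2) 1%g v + 1 <= r%:R ->
    dist R (gens 2) 1%g u <= r%:R.
  have [n [-> w mn]] := distE R two 1%g v.
  rewrite natr1 ler_nat => vu nr; apply/D; exists n.+1 => //.
  by rewrite -[n.+1]addn1; exact: (walk_cat w (@walk1 2 anywhere _ _ I I vu)).
(* The parameters 0 and 1 give the two ends. The minimum may be attained by way of the other end,
   whence [step]. *)
have := E 0; have := E 1; rewrite /edge_in_ball /dist_point /= !subr0 subrr !addr0 !lexx !ler01.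
move=> /(_ isT); rewrite ge_min => /orP h1 /(_ isT); rewrite ge_min => /orP h2.
split; [apply/(D g)|apply/(D (g * a)%g)].
  by case: h2 => // /step; apply; apply: adj_sym.
by case: h1 => // /step; apply.
Qed.

Lemma peak_sphere (R : realType) (h : nat) (g : bs) : (2 <= h)%N ->
  bsval g = (2 * pw h - 2, 1) \/ bsval g = (2 * pw h - 3, 1) ->
  sphere R (gens 2) (2 * h - 1) g.
Proof.
move=> h2 hg; have H2 : 4 <= pw h by rewrite (_ : 4 = pw 2) //; apply: ler_pw; lia.
have [n [e w mn]] := distE R (isT : (0 < 2)%N) 1%g g.
have [n' e' w'] : exists2 n', n' = (2 * h - 1)%N & walk 2 anywhere (0, 0) (bsval g) n'.
  (* Climbing [h] times with [(2, 1)] gives [2 * 2 ^ h - 2]; one less is obtained by starting with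
     [(1, 1)]. *)
  case: hg => ->.
    have [||n' en' w'] := @walk_peak (-2) 0 h; [lia|lia|].
    by exists n'; [lia|move: w'; rewrite pw0 mulr1 subrr].
  have [||n' en' w'] := @walk_peak (-3) 1 h; [lia|lia|].
  exists n'.+1; first by lia.
  by apply: WalkS _ w' => //; left; exists 1%N.
have lo : (2 * h - 1 <= n)%N.
  have h0 : (0 < h)%N by lia.
  by case: hg w => -> w; apply: (walk_far h0 w); lra.
have hi := mn _ w'.
by rewrite /sphere /= e; congr (_%:R); lia.
Qed.

Lemma dyadic_peak (h i : nat) : dyadic ((2 * pw h - i%:R, 1) : vert).1.
Proof.
have dh : dy 0 (pw h) by rewrite dy_pw.
by apply/asboolP; exists 0; rewrite /= dyB ?dy_nat // mulr_natl mulr2n dyD.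
Qed.

Lemma gens2_not_MAC (R : realType) : ~ MAC R (gens 2).
Proof.
move=> [r0 H]; pose h := r0.+2.
pose a := Bs (dyadic_peak h 2); pose b := Bs (dyadic_peak h 3).
have sa : sphere R (gens 2) (2 * h - 1) a by apply: peak_sphere => //; left.
have sb : sphere R (gens 2) (2 * h - 1) b by apply: peak_sphere => //; right.
have ab : dist R (gens 2) a b <= 2%:R.
  apply/(dist_le R (isT : (0 < 2)%N)); exists 2%N => //.
  apply: (@WalkS _ _ _ (2 * pw h - 4, 0)) => //.
    by right; exists 2%N => //; rewrite upvP pw0 mulr1; congr pair; ring.
  apply: walk1 => //; left; exists 1%N => //.
  by rewrite upvP pw0 mulr1; congr pair; ring.
have [|n [w nr]] := H (2 * h - 1)%N _ a b sa sb ab; first by rewrite /h; lia.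
have ba : ball2 (2 * h - 1) (bsval a).
  by apply/(dist_le R (isT : (0 < 2)%N) 1%g); move: sa; rewrite /sphere /= => ->.
have {}w : walk 2 (ball2 (2 * h - 1)) (bsval a) (bsval b) n.
  by apply: edge_walk ba w => g c gc; apply: edge_in_ball2.
have : (2 * (2 * h - 1) <= n)%N by apply: detour2 w.
rewrite -(ler_nat R) natrM; lra.
Qed.

(** * Quasi-isometry, finite generation and commensurability *)

Lemma adj2_walk p q : adj 2 p q -> exists2 n, (n <= 3)%N & walk 1 anywhere p q n.
Proof.
have up2 u v : up 2 u v -> exists2 n, (n <= 3)%N & walk 1 anywhere u v n.
  case: u => u k [[|[|[|i]]]] // _ ->; rewrite upvP.
  - by exists 1%N => //; apply: walk1 => //; rewrite mul0r addr0; apply: adjU0.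
  - by exists 1%N => //; apply: walk1 => //; rewrite mul1r; apply: adjU1.
  (* The new generator is a product of three old ones: [(2, 1) = (1, 1) (0, 1)^-1 (1, 1)]. *)
  exists 3%N => //; apply: (WalkS _ (adjU1 u k)) => //.
  apply: (WalkS _ (adj_sym (adjU0 _ _))) => //; apply: walk1 => //.
  by have := adjU1 (u + pw k) k; rewrite (_ : u + 2%:R * pw k = u + pw k + pw k) //; ring.
case=> /up2 // [n n3 w]; exists n => //; exact: walk_rev.
Qed.

Lemma walk2_walk1 S p q n : walk 2 S p q n ->
  exists2 n', (n' <= 3 * n)%N & walk 1 anywhere p q n'.
Proof.
elim=> [{}p _|{}p s {}q {}n _ /adj2_walk[m m3 w] _ [n' nn w']].
  by exists 0 => //; apply: Walk0.
by exists (m + n')%N; [lia|apply: walk_cat w'].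
Qed.

Lemma gens_quasi_isometric (R : realType) :
  quasi_isometric (dist R (gens 1)) (dist R (gens 2)).
Proof.
exists id, 3%:R, 0; split.
- by rewrite ler1n.
- by [].
- move=> u v; have [n [-> w mn]] := distE R (isT : (0 < 1)%N) u v.
  have [m [-> w' mm]] := distE R (isT : (0 < 2)%N) u v.
  have [n' nn w2] := walk2_walk1 w'.
  have h1 : n%:R <= (3 * m)%:R :> R by rewrite ler_nat (leq_trans (mn _ w2)).
  have h2 : m%:R <= n%:R :> R by rewrite ler_nat; apply/mm/(walkWd _ w).
  have h3 : 0 <= n%:R :> R by rewrite ler0n.
  by move: h1; rewrite natrM => h1; apply/andP; split; lra.
move=> v; exists v; have [n [-> _ mn]] := distE R (isT : (0 < 2)%N) v v.
by rewrite (_ : n = 0%N) //; have := mn 0%N (Walk0 _ I); lia.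
Qed.

Lemma subgroup_edge_path (G : groupType) (A K : set G) (E : set (G * G)) u v n :
  subgroup K -> A `<=` K -> edge_path A E u v n -> K u -> K v.
Proof.
move=> [K1 KB] AK.
have KV x : K x -> K x^-1%g.
  by move=> /mem_set kx; apply/set_mem; rewrite -[x^-1%g]mul1g KB.
have KM x y : K x -> K y -> K (x * y)%g.
  move=> /mem_set kx /KV /mem_set ky; apply/set_mem.
  by rewrite -[y]invgK KB.
elim=> // [{}u a {}v {}n /AK Ka _ _ IH Ku|{}u a {}v {}n /AK Ka _ _ IH Ku].
  by apply: IH; apply: KM.
by apply: IH; rewrite -[u](mulgK a); apply: KM (KV _ Ka).
Qed.

Lemma gens_finite_generating d : (0 < d)%N -> finite_generating (gens d).
Proof.
move=> d0; split.
  apply: finite_image; apply: (@sub_finite_set _ _ `I_d.+1); last exact: finite_II.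
  by move=> i /=; rewrite ltnS.
move=> K sK AK; apply/seteqP; split=> // g _.
have [n w] := gens_walk 1%g g d0.
apply: (subgroup_edge_path sK AK (E := setT) (u := 1%g) (n := n)).
  exact/edge_path_walk.
by case: sK => /set_mem.
Qed.

Lemma commensurable_refl (G : groupType) : commensurable G G.
Proof.
have sT : @subgroup G setT by split=> [|x y _ _]; apply/mem_set.
have fT : @finite_index G setT.
  rewrite /finite_index (_ : (fun g : G => _) = cst setT); first exact: finite_image_cst.
  apply/funext => g; apply/seteqP; split=> // x _ /=.
  by exists (g^-1 * x)%g => //; rewrite mulVKg.
by exists setT, setT, id; split=> //; split=> // x _; exists x.
Qed.

Theorem corollary4p6 (R : realType) (Q : forall G : groupType, set G -> Prop)
    (hQ : Q = @MAC R \/ Q = @MpAC R) :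
  exists (G H : groupType) (A : set G) (B : set H),
    finite_generating A /\ finite_generating B /\
    commensurable G H /\
    quasi_isometric (dist R A) (dist R B) /\
    Q G A /\ ~ Q H B.
Proof.
exists bs, bs, (gens 1), (gens 2).
do 2![split; first exact: gens_finite_generating].
split; first exact: commensurable_refl.
split; first exact: gens_quasi_isometric.
case: hQ => ->; split.
- exact/MpAC_MAC/gens1_MpAC.
- exact: gens2_not_MAC.
- exact: gens1_MpAC.
- by move/MpAC_MAC; apply: gens2_not_MAC.
Qed.
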